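(* There exists an absolute constant $C>0$ such that for all $n\in\mathbb{N}$, $$C^{-1}\sqrt{n^{-1}}\le\mathrm{Risk}_{\mathsf{rnwl}}(n)\le C\sqrt{n^{-1}}.$$
   Context: Renewal process: let $T_0,T_1,T_2,\dots$ be independent $\mathbb{N}$-valued random variables ($\mathbb{N}=\{1,2,\dots\}$), where $T_1,T_2,\dots$ are i.i.d. from a distribution $\mu$ on $\mathbb{N}$ with finite mean. The renewal process $\{X_t:t\ge1\}$ is the binary process with $\{t:X_t=1\}=\{T_0,T_0+T_1,T_0+T_1+T_2,\dots\}$. It is stationary if and only if $\mathbb{P}(T_0=t)=\frac{1}{\mathbb{E}_\mu[T_1]}\sum_{s\ge t}\mu(s)$ for $t\in\mathbb{N}$. $\mathcal{P}^{\mathsf{rnwl}}_n$ denotes the collection of joint distributions of $X^{n+1}=(X_1,\dots,X_{n+1})$ for stationary renewal processes, over all interarrival distributions $\mu$ with finite mean. The prediction risk is $$\mathrm{Risk}_{\mathsf{rnwl}}(n)=\inf_{Q_{X_{n+1}|X^n}}\ \sup_{P\in\mathcal{P}^{\mathsf{rnwl}}_n}\mathbb{E}_{P}\big[\mathrm{KL}(P_{X_{n+1}|X^n}\,\|\,Q_{X_{n+1}|X^n})\big],$$ where the infimum is over all conditional distributions $Q_{X_{n+1}|X^n}$ (estimators), $X^n=(X_1,\dots,X_n)$, and $\mathrm{KL}$ is the Kullback-Leibler divergence. *)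

(* Defs.v *)
From HB Require Import structures.
From mathcomp Require Import all_boot all_order all_algebra.
From mathcomp Require Import all_classical all_reals all_analysis.

Set Implicit Arguments.
Unset Strict Implicit.
Unset Printing Implicit Defensive.

Import Order.TTheory GRing.Theory Num.Theory.

Local Open Scope classical_set_scope.
Local Open Scope ring_scope.

Section Processes.
Context {R : realType} {d : measure_display} {Omega : measurableType d}.
Variable P : probability Omega R.

Definition mutually_independent (I : eqType) d' (S : measurableType d')
    (Y : I -> {RV P >-> S}) : Prop :=
  forall (s : seq I) (B : I -> set S), uniq s ->
    (forall i, measurable (B i)) ->
    P (\bigcap_(i in [set` s]) (Y i @^-1` B i)) =
    (\prod_(i <- s) P (Y i @^-1` B i))%E.

(* [mu] is the law of T_1, T_2, ... only; the law of the initial delay T_0 is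
   left free. Since [nat] contains 0, positivity is imposed separately. *)
Definition renewal_times (mu : probability nat R) (T : nat -> {RV P >-> nat}) :
    Prop :=
  [/\ mutually_independent T,
      forall k w, (0 < T k w)%N,
      forall k (A : set nat), distribution P (T k.+1) A = mu A &
      (\int[mu]_t (t%:R)%:E < +oo)%E].

(* The value at [t = 0] is irrelevant: processes are indexed by t >= 1. *)
Definition renewal_process (T : nat -> {RV P >-> nat}) (t : nat) (w : Omega) :
    bool :=
  `[< exists k : nat, (\sum_(i < k.+1) T i w)%N = t >].

(* (X_{s+1}, ..., X_{s+m}) *)
Definition block (X : nat -> Omega -> bool) (s m : nat) (w : Omega) :
    m.-tuple bool :=
  [tuple X (s + i.+1)%N w | i < m].

Definition block_law (X : nat -> Omega -> bool) (s m : nat)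
    (x : m.-tuple bool) : R :=
  fine (P [set w | block X s m w = x]).

Definition stationary (X : nat -> Omega -> bool) : Prop :=
  forall (s m : nat) (x : m.-tuple bool), block_law X s x = block_law X 0 x.

End Processes.

Section Risk.
Context {R : realType}.

Definition renewal_laws (n : nat) : set ((n.+1).-tuple bool -> R) :=
  [set p | exists (d : measure_display) (Omega : measurableType d)
      (P : probability Omega R) (mu : probability nat R)
      (T : nat -> {RV P >-> nat}),
    [/\ renewal_times mu T,
        stationary P (renewal_process T) &
        p = @block_law R d Omega P (renewal_process T) 0 n.+1]].
Arguments renewal_laws : clear implicits.

Definition is_pmf (A : finType) (p : A -> R) : Prop :=
  (forall a, 0 <= p a) /\ \sum_a p a = 1.

(* Conventions: 0 log (0 / q) = 0, and p log (p / 0) = +oo for p > 0. *)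
Definition kl_div (A : finType) (p q : A -> R) : \bar R :=
  (\sum_(a : A) if p a == 0%R then 0
                else if q a == 0%R then +oo
                else (p a * ln (p a / q a))%:E)%E.

Definition past_marginal (n : nat) (p : (n.+1).-tuple bool -> R)
    (x : n.-tuple bool) : R :=
  \sum_(b : bool) p [tuple of rcons x b].

(* Equal to 0 when [x] has probability 0; such [x] carry zero weight in
   [prediction_risk]. *)
Definition next_given_past (n : nat) (p : (n.+1).-tuple bool -> R)
    (x : n.-tuple bool) (b : bool) : R :=
  p [tuple of rcons x b] / past_marginal p x.

Definition prediction_risk (n : nat) (p : (n.+1).-tuple bool -> R)
    (Q : n.-tuple bool -> bool -> R) : \bar R :=
  (\sum_(x : n.-tuple bool)
     (past_marginal p x)%:E * kl_div (next_given_past p x) (Q x))%E.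

Definition estimators (n : nat) : set (n.-tuple bool -> bool -> R) :=
  [set Q | forall x, is_pmf (Q x)].
Arguments estimators : clear implicits.

Definition risk_rnwl (n : nat) : \bar R :=
  ereal_inf [set ereal_sup [set prediction_risk p Q | p in renewal_laws n]
            | Q in estimators n].

End Risk.

(* Main.v *)
From HB Require Import structures.
Require Import Defs.
From mathcomp Require Import all_boot all_order all_algebra.
From mathcomp Require Import all_classical all_reals all_analysis.
From mathcomp Require Import measurable_realfun.
From mathcomp Require Import ring lra zify.

(** Both bounds come from an explicit formula for the law of a binary string.
If [A] and [M] are the survival functions of the delay and of the gaps, then
reading a string from left to right multiplies one factor per completed gap
and one survival factor for the last, incomplete gap; this is [law A M 0 x]
([block_law0]). Stationarity becomes the statement that summing over one more
symbol on the left leaves [law A M 0] unchanged ([stationary_law]).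

Upper bound. Given the position of the first renewal, a string has a
probability that depends only on the multiset of its completed gaps and on its
last age. Giving each such class of strings of length [N] total mass one
produces a weight [W] that dominates all these conditional probabilities
([law_le_type_weight]), and its total mass is at most [(N + 1)^2] times the
number of partitions of integers at most [N], which is [exp (O (sqrt N))]
([card_multiplicities_le], through the generating function of partitions).
From [W] one gets a predictor of the next symbol for each length of observed
suffix, and the estimator averages these predictors over the [n + 1] possible
lengths. By concavity of the logarithm and stationarity, [n + 1] times its risk
is bounded by the cumulative loss of a sequential prediction of the string,
which telescopes to the logarithm of the total mass of [W]
([prediction_risk_le]). Two features of renewal processes replace the chain
rule for the entropy: once a suffix contains a renewal, the older past is
irrelevant, and before the first renewal the conditional probability is simply
bounded by one ([ln_cond_le]). Hence a risk of order [sqrt n / n].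

Lower bound. Take gaps in [m + 1, m + 2 L] with [m] and [L] of order
[sqrt n], where inside each pair of consecutive values the mass [1 / L] is
split as [4/5, 1/5] or [1/5, 4/5] according to a sign. A window of
length [n] contains [O (sqrt n)] gaps, so with probability at least one half no
gap of the window falls in a given pair ([sum_law_avoiding_ge]), and then the
sign of that pair is invisible. At an age preceding that pair, the probability
that the next symbol is a renewal is of order [1 / L] and changes by a factor
4 with the sign, so that one of the two laws causes a squared Hellinger
distance of order [1 / L] ([pair_share_separation]). Averaging over all signs
and summing over pairs gives some law with risk at least of order [1 / L]
([exists_hard_signs]). Such a law belongs to the class because a stationary
renewal process with prescribed gaps is built on the unit interval, by reading
the successive gaps from one uniform variable ([coded_rv_independent],
[equilibrium_renewal_law]). *)

Set Implicit Arguments.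
Unset Strict Implicit.
Unset Printing Implicit Defensive.

Import Order.TTheory GRing.Theory Num.Theory.
Local Open Scope ring_scope.

(** * Binary strings and their renewal probabilities *)

Section BinaryStrings.
Variable V : nmodType.
Implicit Types F : seq bool -> V.

Lemma sum_tuple0 F : \sum_(x : 0.-tuple bool) F x = F [::].
Proof.
rewrite (eq_bigr (fun=> F [::])) => [|x _]; last by rewrite tuple0.
by rewrite sumr_const card_tuple expn0.
Qed.

Lemma sum_tuple_cons n F :
  \sum_(x : n.+1.-tuple bool) F x =
  \sum_(x : n.-tuple bool) \sum_(b : bool) F (b :: x).
Proof.
rewrite pair_bigA /=.
rewrite (reindex (fun p : n.-tuple bool * bool => [tuple of p.2 :: p.1])) //.
exists (fun x : n.+1.-tuple bool => ([tuple of behead x], thead x)) => [[x b] _|x _] /=.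
  by rewrite theadE; congr (_, _); apply/val_inj.
by rewrite [RHS]tuple_eta; apply/val_inj.
Qed.

Lemma sum_tuple_rev n F :
  \sum_(x : n.-tuple bool) F (rev x) = \sum_(x : n.-tuple bool) F x.
Proof.
rewrite [RHS](reindex_inj (h := fun x : n.-tuple bool => [tuple of rev x])) //.
by move=> x y /(congr1 val)/= /(can_inj revK)/val_inj.
Qed.

Lemma sum_tuple_rcons n F :
  \sum_(x : n.+1.-tuple bool) F x =
  \sum_(x : n.-tuple bool) \sum_(b : bool) F (rcons x b).
Proof.
rewrite -sum_tuple_rev (sum_tuple_cons n (fun x => F (rev x))).
rewrite -(sum_tuple_rev n (fun x => \sum_b F (rcons x b))).
by apply: eq_bigr => x _; apply: eq_bigr => b _; rewrite rev_cons.
Qed.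

(** Splitting according to the position of the first renewal; applied to
reversed strings, it classifies pasts by their age. *)
Lemma sum_tuple_first_one n F :
  \sum_(x : n.+1.-tuple bool) F x =
  \sum_(r < n.+1) \sum_(y : (n - r).-tuple bool) F (nseq r false ++ true :: y)
  + F (nseq n.+1 false).
Proof.
elim: n F => [|n IHn] F.
  rewrite sum_tuple_cons (sum_tuple0 (fun x => \sum_b F (b :: x))) big_bool/=.
  rewrite big_ord_recl big_ord0 addr0; congr (_ + _).
  by rewrite (sum_tuple0 (fun y => F (true :: y))).
rewrite sum_tuple_cons (eq_bigr (fun x : n.+1.-tuple bool => F (true :: x) + F (false :: x))).
  rewrite big_split /= (IHn (fun x => F (false :: x))).
  rewrite addrA [in RHS]big_ord_recl /=; congr (_ + _ + _).
by move=> x _; rewrite big_bool.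
Qed.

End BinaryStrings.

Section RenewalWeights.
Variable R : comNzRingType.
Implicit Types (A M : nat -> R) (r : nat) (x u v : seq bool).

(** Probability of the string [x] for a renewal process observed at age [r],
where [A] is the survival function of the current gap and [M] that of all later
gaps; a gap equals [r + 1] with mass [A r - A r.+1]. *)
Fixpoint law A M r x : R :=
  match x with
  | [::] => A r
  | b :: y => if b then (A r - A r.+1) * law M M 0 y else law A M r.+1 y
  end.

(** Probability that the string [x] is read and followed by a renewal. It is
what remains of [law] when the string is cut at a renewal. *)
Fixpoint hit A M r x : R :=
  match x with
  | [::] => A r - A r.+1
  | b :: y => if b then (A r - A r.+1) * hit M M 0 y else hit A M r.+1 y
  end.

Lemma law_rcons A M r x : M 0 = 1 ->
  \sum_(b : bool) law A M r (rcons x b) = law A M r x.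
Proof.
move=> M0; elim: x A r => [|[] x IHx] A r; rewrite big_bool /= ?M0; first by ring.
  by rewrite -mulrDr -(IHx M 0%N) big_bool.
by rewrite -IHx big_bool.
Qed.

(** A renewal separates the past from the future. *)
Lemma law_cat_one A M r u v :
  law A M r (u ++ true :: v) = hit A M r u * law M M 0 v.
Proof.
by elim: u A r => [|[] u IHu] A r //=; rewrite IHu ?mulrA.
Qed.

Lemma eq_law A A' M M' r x : A =1 A' -> M =1 M' -> law A M r x = law A' M' r x.
Proof.
move=> AA MM; elim: x A A' AA r => [|[] x IHx] A A' AA r /=; first exact: AA.
  by rewrite !AA (IHx M M').
exact: IHx.
Qed.

Lemma hit_cat_one A M r u v :
  hit A M r (u ++ true :: v) = hit A M r u * hit M M 0 v.
Proof.
by elim: u A r => [|[] u IHu] A r //=; rewrite IHu ?mulrA.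
Qed.

Lemma law_zeros A M r k : law A M r (nseq k false) = A (r + k)%N.
Proof. by elim: k r => [|k IHk] r; rewrite /= ?addn0 // IHk addSnnS. Qed.

Lemma hit_zeros A M r k :
  hit A M r (nseq k false) = A (r + k)%N - A (r + k).+1.
Proof. by elim: k r => [|k IHk] r; rewrite /= ?addn0 // IHk addSnnS. Qed.

Lemma nseq_cat_cons k x : nseq k false ++ false :: x = nseq k.+1 false ++ x.
Proof. by elim: k => //= k ->. Qed.

(** Reversing a string that starts and ends with a renewal reverses the list
of its gaps, and the product of their masses is unchanged. *)
Lemma hit_rev M u : hit M M 0 (rev u) = hit M M 0 u.
Proof.
suff H r : hit M M r u = hit M M 0 (rev (nseq r false ++ u)) by rewrite (H 0%N).
elim: u r => [|[] u IHu] r /=.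
- by rewrite cats0 rev_nseq hit_zeros add0n.
- rewrite rev_cat rev_cons cat_rcons hit_cat_one rev_nseq hit_zeros add0n mulrC.
  by rewrite (IHu 0%N).
- by rewrite IHu nseq_cat_cons.
Qed.

Section Stationary.
Variables (A M : nat -> R) (c : R).
Hypothesis Ac : forall t, A t - A t.+1 = c * M t.

(** Time reversal of the stationary process: the delay being proportional to
the survival function of the gaps, a string followed by a renewal read
backwards is a string that starts afresh from a renewal. *)
Lemma hit_stationary_rev u : hit A M 0 (rev u) = c * law M M 0 u.
Proof.
suff H r v : hit A M r v = c * law M M 0 (rev (nseq r false ++ v)).
  by rewrite (H 0%N) revK.
elim: v r => [|[] v IHv] r /=.
- by rewrite cats0 rev_nseq law_zeros add0n.
- by rewrite rev_cat rev_cons cat_rcons law_cat_one rev_nseq law_zeros hit_rev Ac; ring.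
- by rewrite IHv nseq_cat_cons.
Qed.

(** With an equilibrium delay, a delay [t] in the shifted process comes either
from a delay [t + 1] or from a delay 1 followed by a gap [t], and
[A t - A t.+1 = (A t.+1 - A t.+2) + c * (M t - M t.+1)]. *)
Lemma law_stationary x : M 0 = 1 ->
  \sum_(b : bool) law A M 0 (b :: x) = law A M 0 x.
Proof.
move=> M0; rewrite big_bool /= Ac M0 mulr1.
(* The statement for all ages [r], of which the claim is the case [r = 0]. *)
suff H r : c * law M M r x + law A M r.+1 x = law A M r x by exact: H.
elim: x r => [|[] x IHx] r /=; last exact: IHx.
  by rewrite -Ac; ring.
by rewrite Ac (Ac r) -(subrK (M r.+1) (M r)); ring.
Qed.

End Stationary.
End RenewalWeights.

Section Survival.
Variable R : numDomainType.
Implicit Types (A M : nat -> R) (r : nat) (x : seq bool).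

(** The two properties of a tail [r |-> P (T > r)] that make string
probabilities nonnegative. The value at 0 is left free because the lower bound
also uses defective gap distributions, of total mass less than 1. *)
Definition survival A := (forall r, 0 <= A r) /\ (forall r, A r.+1 <= A r).

Lemma law_ge0 A M r x : survival A -> survival M -> 0 <= law A M r x.
Proof.
move=> sA sM; elim: x A sA r => [|[] x IHx] A sA r /=; first exact: sA.1.
  by rewrite mulr_ge0 ?subr_ge0 ?sA.2 ?IHx.
exact: IHx.
Qed.

Lemma hit_ge0 A M r x : survival A -> survival M -> 0 <= hit A M r x.
Proof.
move=> sA sM; elim: x A sA r => [|[] x IHx] A sA r /=; first by rewrite subr_ge0 sA.2.
  by rewrite mulr_ge0 ?subr_ge0 ?sA.2 ?IHx.
exact: IHx.
Qed.

Lemma law_mono M M' r x : survival M' -> (forall t, M' t <= M t) ->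
  (forall t, M' t - M' t.+1 <= M t - M t.+1) -> law M' M' r x <= law M M r x.
Proof.
move=> sM' le le'; elim: x r => [|[] x IHx] r //=.
by rewrite ler_pM ?subr_ge0 ?sM'.2 ?law_ge0.
Qed.

Lemma sum_law A M r n : M 0 = 1 -> \sum_(x : n.-tuple bool) law A M r x = A r.
Proof.
move=> M0; elim: n => [|n IHn]; first by rewrite sum_tuple0.
by rewrite sum_tuple_rcons -IHn; apply: eq_bigr => x _; rewrite law_rcons.
Qed.

End Survival.

(** * Gap distributions with hidden signs *)

Section DefectiveRenewal.
Variables (R : realFieldType) (N : nat -> R) (m : nat) (theta : R).
Hypotheses (sN : survival N) (theta0 : 0 <= theta).
Hypothesis Nm : forall r, (r <= m)%N -> N r = 1 - theta * m.+1%:R.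

Let F r k := \sum_(y : k.-tuple bool) law N N r y.

Let FS r k : F r k.+1 = (N r - N r.+1) * F 0 k + F r.+1 k.
Proof.
rewrite /F sum_tuple_cons mulr_sumr -big_split.
by apply: eq_bigr => y _; rewrite big_bool.
Qed.

(** Total weight of the strings of length [k] when the gap distribution, which
charges only values above [m], lacks a mass [theta * (m + 1)]. A renewal costs
the missing mass once but consumes at least [m + 1] units of time, so the total
loss grows at most like [theta] per unit of time. *)
Lemma sum_law_defective_ge k :
  1 - theta * (k + m).+1%:R <= \sum_(y : k.-tuple bool) law N N 0 y.
Proof.
(* Below age [m] no renewal is possible, so only time is lost; above it, what
   is left is compared with the survival probability. *)
suff [H _] : (forall r, (r <= m)%N -> 1 - theta * (k + r + m).+1%:R <= F r k) /\
  (forall r, (m <= r)%N -> N r * (1 - theta * (k + m)%:R) <= F r k).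
  by have := H 0%N (leq0n _); rewrite addn0.
elim: k => [|k [IHA IHB]].
  have F0 r : F r 0 = N r by rewrite /F sum_tuple0.
  split=> r rm; rewrite F0; last first.
    by rewrite ler_piMr ?sN.1// gerBl mulr_ge0.
  by rewrite Nm // lerB// ler_wpM2l// ler_nat; lia.
have B r : (m <= r)%N -> N r * (1 - theta * (k.+1 + m)%:R) <= F r k.+1.
  move=> mr; rewrite FS.
  have h1 : (N r - N r.+1) * (1 - theta * (k + m).+1%:R) <= (N r - N r.+1) * F 0 k.
    by rewrite ler_wpM2l ?subr_ge0 ?sN.2//; have := IHA 0%N (leq0n _); rewrite addn0.
  have h2 := IHB r.+1 (leqW mr).
  have h3 : 0 <= theta * N r.+1 by rewrite mulr_ge0 ?sN.1.
  move: h1 h2 h3; rewrite addSn -natr1; nra.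
split=> // r; rewrite leq_eqVlt => /orP[/eqP->|rm].
  apply: le_trans (B m (leqnn _)); rewrite Nm//.
  have h : 0 <= (theta * m.+1%:R) * (theta * (k.+1 + m)%:R) by rewrite !mulr_ge0.
  have -> : (k.+1 + m + m).+1 = (m.+1 + (k.+1 + m))%N by lia.
  by rewrite natrD; nra.
rewrite FS !Nm ?(ltnW rm)// subrr mul0r add0r.
by apply: le_trans (IHA _ rm); rewrite addSnnS.
Qed.

End DefectiveRenewal.

Section SignedFamily.
Variables (R : rcfType) (m L : nat).
Hypothesis L0 : (0 < L)%N.
Implicit Types (f : {ffun 'I_L -> bool}) (i : 'I_L) (r : nat).

(** The ratio 4 makes the two square roots in a Hellinger distance
commensurable. *)
Definition pair_share (b : bool) : R := if b then 4 / 5 else 1 / 5.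

(** The pair [i] consists of the gaps [m + 2 i + 1] and [m + 2 i + 2], has
mass [1 / L], and the sign [f i] tells which of them gets the larger share.
Restricting to the pairs in [D] gives the defective distribution of the gaps
that reveal only the signs in [D]. *)
Definition signed_tail (D : pred 'I_L) f r : R :=
  \sum_(i | D i) \sum_(b : bool)
    (r <= m + i.*2 + b)%N%:R * (pair_share (f i (+) b) / L%:R).

Definition signed_surv := signed_tail xpredT.

Lemma pair_share_ge0 b : 0 <= pair_share b / L%:R.
Proof. by rewrite divr_ge0 //; case: b; rewrite /pair_share; lra. Qed.

Lemma signed_tail_survival D f : survival (signed_tail D f).
Proof.
split=> r; first by do 2![apply: sumr_ge0 => ? _]; rewrite mulr_ge0 ?pair_share_ge0.
do 2![apply: ler_sum => ? _]; rewrite ler_wpM2r ?pair_share_ge0// ler_nat.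
by do 2!case: leqP => //; lia.
Qed.

Lemma signed_tail_le D f r : signed_tail D f r <= signed_surv f r.
Proof.
rewrite /signed_surv /signed_tail [leRHS](bigID D)/= lerDl.
by do 2![apply: sumr_ge0 => ? _]; rewrite mulr_ge0 ?pair_share_ge0.
Qed.

Lemma signed_mass D f r :
  signed_tail D f r - signed_tail D f r.+1 =
  \sum_(i | D i) \sum_(b : bool)
    (r == m + i.*2 + b)%N%:R * (pair_share (f i (+) b) / L%:R).
Proof.
rewrite /signed_tail -sumrB; apply: eq_bigr => i _.
rewrite -sumrB; apply: eq_bigr => b _; rewrite -mulrBl; congr (_ * _).
by case: ltngtP => _; rewrite ?subr0 ?subrr.
Qed.

Lemma signed_mass_le D f r :
  signed_tail D f r - signed_tail D f r.+1 <= signed_surv f r - signed_surv f r.+1.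
Proof.
rewrite !signed_mass [leRHS](bigID D)/= lerDl.
by do 2![apply: sumr_ge0 => ? _]; rewrite mulr_ge0 ?pair_share_ge0.
Qed.

Lemma pair_share_sum f i : \sum_(b : bool) pair_share (f i (+) b) / L%:R = L%:R^-1.
Proof.
rewrite big_bool; case: (f i); rewrite /pair_share /= -mulrDl -[RHS]mul1r;
  by congr (_ * _); lra.
Qed.

Lemma signed_tail_below D f r : (r <= m)%N -> signed_tail D f r = #|D|%:R / L%:R.
Proof.
move=> rm; rewrite /signed_tail (eq_bigr (fun=> L%:R^-1)).
  by rewrite sumr_const mulr_natl.
move=> i _; rewrite -[RHS](pair_share_sum f i); apply: eq_bigr => b _.
by rewrite (_ : leq _ _) ?mul1r // -addnA (leq_trans rm) ?leq_addr.
Qed.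

Lemma signed_surv0 f : signed_surv f 0 = 1.
Proof.
by rewrite /signed_surv signed_tail_below // card_ord divff // pnatr_eq0 -lt0n.
Qed.

(** At the age preceding the pair [i], the mass of the remaining pairs does
not involve any sign. *)
Lemma signed_surv_even f i : signed_surv f (m + i.*2) = (L - i)%:R / L%:R.
Proof.
rewrite /signed_surv /signed_tail.
rewrite (eq_bigr (fun j : 'I_L => (i <= j)%N%:R * L%:R^-1)); last first.
  move=> j _; rewrite -[X in _ = _ * X](pair_share_sum f j) mulr_sumr.
  apply: eq_bigr => b _; congr (_%:R * _).
  by congr (nat_of_bool _); case: b; apply/idP/idP; lia.
rewrite -mulr_suml -natr_sum; congr (_%:R * _).
rewrite -(big_mkord xpredT (fun j => nat_of_bool (i <= j)%N)).
rewrite (big_cat_nat (n := i)) ?(ltnW (ltn_ord i))//=.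
rewrite big_nat big1 ?add0n; last by move=> j; case: leqP => //; lia.
rewrite big_nat (eq_bigr (fun=> 1%N)) -?big_nat ?sum_nat_const_nat ?muln1//.
by move=> j /andP[-> _].
Qed.

Lemma signed_surv_mass f i :
  signed_surv f (m + i.*2) - signed_surv f (m + i.*2).+1 = pair_share (f i) / L%:R.
Proof.
rewrite signed_mass (bigD1 i)//= [X in _ + X]big1 ?addr0 => [|j ji].
  rewrite big_bool /= addn0 eqxx mul1r addbF.
  by rewrite (_ : (_ == _) = false) ?mul0r ?add0r//; apply/eqP; lia.
apply: big1 => b _; rewrite (_ : (_ == _) = false) ?mul0r//.
by apply/eqP; move: ji; rewrite -val_eqE /=; case: b => /=; lia.
Qed.

Lemma signed_surv_above f r : (m + L.*2 <= r)%N -> signed_surv f r = 0.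
Proof.
move=> rK; rewrite /signed_surv /signed_tail big1 // => i _; apply: big1 => b _.
rewrite (_ : leq _ _ = false) ?mul0r//; have := ltn_ord i.
by case: b => /=; lia.
Qed.

Lemma signed_tail_eq (D : pred 'I_L) f (g : {ffun 'I_L -> bool}) :
  (forall i, D i -> f i = g i) -> signed_tail D f =1 signed_tail D g.
Proof. by move=> fg r; apply: eq_bigr => i Di; rewrite fg. Qed.

End SignedFamily.

(** * The lower bound for Hellinger risks *)

Section Equilibrium.
Variables (R : realFieldType) (K : nat) (M : nat -> R).
Hypotheses (M0 : M 0 = 1) (sM : survival M) (MK : forall r, (K <= r)%N -> M r = 0).

(** The mean of the gaps, as the sum of their survival function. *)
Definition mean_time := \sum_(t < K) M t.
(** The delay of the stationary process: its mass at [t + 1] is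
[M t / mean_time]. *)
Definition equilibrium r := (\sum_(t < K | (r <= t)%N) M t) / mean_time.

Lemma surv_le1 r : M r <= 1.
Proof. by elim: r => [|r IHr]; rewrite ?M0// (le_trans (sM.2 r)). Qed.

Lemma surv_bound_gt0 : (0 < K)%N.
Proof.
rewrite lt0n; apply: contraTneq isT => K0.
by have := MK (r := 0); rewrite K0 M0 => /(_ isT)/eqP; rewrite oner_eq0.
Qed.

Lemma mean_time_ge1 : 1 <= mean_time.
Proof.
rewrite /mean_time (bigD1 (Ordinal surv_bound_gt0))//= M0 lerDl.
by apply: sumr_ge0 => i _; exact: sM.1.
Qed.

Lemma mean_time_le : mean_time <= K%:R.
Proof.
rewrite -[leRHS]mulr1 mulr_natl -[in leRHS](card_ord K) -sumr_const.
by apply: ler_sum => i _; exact: surv_le1.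
Qed.

Lemma equilibrium0 : equilibrium 0 = 1.
Proof.
by rewrite /equilibrium divff // gt_eqF // (lt_le_trans ltr01 mean_time_ge1).
Qed.

Lemma equilibrium_step t :
  equilibrium t - equilibrium t.+1 = mean_time^-1 * M t.
Proof.
rewrite /equilibrium -mulrBl mulrC; congr (_ * _).
have [tK|Kt] := ltnP t K.
  rewrite (bigD1 (Ordinal tK))//=.
  rewrite [X in _ + X - _](eq_bigl (fun i : 'I_K => t < i)%N) ?addrK //.
  by move=> i; rewrite ltn_neqAle andbC -val_eqE /= eq_sym.
rewrite MK // !big_pred0 ?subr0// => i; have := ltn_ord i; lia.
Qed.

Lemma equilibrium_survival : survival equilibrium.
Proof.
have E0 : 0 <= mean_time by rewrite (le_trans ler01 mean_time_ge1).
split=> r; first by rewrite divr_ge0 // sumr_ge0 // => i _; exact: sM.1.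
by rewrite -subr_ge0 equilibrium_step mulr_ge0 ?invr_ge0 // sM.1.
Qed.

Lemma equilibrium_above r : (K <= r)%N -> equilibrium r = 0.
Proof.
by move=> Kr; rewrite /equilibrium big_pred0 ?mul0r // => i; have := ltn_ord i; lia.
Qed.

End Equilibrium.

Section Hellinger.
Variable R : rcfType.

(** Prediction risk with the Kullback-Leibler divergence replaced by the part
of the squared Hellinger distance that comes from the symbol 1; being real
valued, it can be averaged over the family of laws. *)
Definition hellinger_risk (p : seq bool -> R) (q : seq bool -> R) n :=
  \sum_(x : n.-tuple bool)
    p x * (Num.sqrt (p (rcons x true) / p x) - Num.sqrt (q x)) ^+ 2.

(** No number is close to the square roots of both hazards: the parallelogram
inequality for [2 * a] and [a], where [a] is the smaller root. *)
Lemma pair_share_separation (k : R) (s : R) : 0 <= k ->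
  k / 10 <= (Num.sqrt (pair_share R true * k) - s) ^+ 2 +
            (Num.sqrt (pair_share R false * k) - s) ^+ 2.
Proof.
move=> k0; rewrite /pair_share; set a := Num.sqrt (1 / 5 * k).
have a2 : a ^+ 2 = k / 5 by rewrite sqr_sqrtr ?mulr_ge0//; lra.
have -> : Num.sqrt (4 / 5 * k) = 2 * a.
  have -> : 4 / 5 * k = (2 * a) ^+ 2 by rewrite exprMn a2; lra.
  by rewrite sqrtr_sqr ger0_norm // mulr_ge0 // sqrtr_ge0.
have -> : k / 10 = a ^+ 2 / 2 by rewrite a2; lra.
by have := sqr_ge0 (3 * a - 2 * s); nra.
Qed.

Lemma ler_sum_inj n I (h : 'I_I -> 'I_n) (H : nat -> R) : injective h ->
  (forall r, 0 <= H r) -> \sum_(i < I) H (h i) <= \sum_(r < n) H r.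
Proof.
move=> hi H0; rewrite [leRHS](bigID (mem (h @: 'I_I)))/=.
by rewrite big_imset /=; [rewrite lerDl sumr_ge0|move=> ? ? _ _; exact: hi].
Qed.

Section Family.
Variables (m L I n : nat).
Hypotheses (L0 : (0 < L)%N) (IL : (I <= L)%N).
Hypothesis ages : forall i, (i < I)%N -> (m + i.*2 < n)%N.
Hypothesis rare : (2 * (n + m) <= m.+1 * L)%N.
Let K := (m + L.*2)%N.
Implicit Types (f : {ffun 'I_L -> bool}) (i : 'I_L).

Definition signed_law f : seq bool -> R :=
  law (equilibrium K (signed_surv R m f)) (signed_surv R m f) 0.

Let surv0 f : signed_surv R m f 0 = 1.
Proof. exact: signed_surv0. Qed.

Let ssurv f : survival (signed_surv R m f).
Proof. exact: signed_tail_survival. Qed.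

Let survK f r : (K <= r)%N -> signed_surv R m f r = 0.
Proof. exact: signed_surv_above. Qed.

Definition flip i f : {ffun 'I_L -> bool} :=
  [ffun j => if j == i then ~~ f j else f j].

Lemma flipK i : involutive (flip i).
Proof. by move=> f; apply/ffunP => j; rewrite !ffunE; case: eqP => // _; rewrite negbK. Qed.

(** Gaps outside the pair [i]; this defective distribution does not depend on
the sign [f i]. *)
Definition surv_avoiding i f := signed_tail R m (predC1 i) f.

(** A past of age [m + 2 i], weighted only through the gaps before its last
renewal that avoid the pair [i]; this lower bound depends on the sign [f i]
only through the hazard [pair_share (f i) / (L - i)]. *)
Lemma hellinger_term_ge f i (y : seq bool) (q : R)
    (x := rev y ++ true :: nseq (m + i.*2) false) :
  law (surv_avoiding i f) (surv_avoiding i f) 0 y / (K * L)%:R * 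
     ((L - i)%:R * (Num.sqrt (pair_share R (f i) / (L - i)%:R) - Num.sqrt q) ^+ 2) <=
  signed_law f x * (Num.sqrt (signed_law f (rcons x true) / signed_law f x) - Num.sqrt q) ^+ 2.
Proof.
set r := (m + i.*2)%N; set M := signed_surv R m f.
have Li : 0 < (L - i)%:R :> R by rewrite ltr0n subn_gt0.
have LR : 0 < L%:R :> R by rewrite ltr0n.
have E1 := mean_time_ge1 (surv0 f) (ssurv f) (@survK f).
have E0 := lt_le_trans ltr01 E1.
have Est := equilibrium_step (@survK f).
set E := mean_time K M in E1 E0 Est *.
have Mr : M r = (L - i)%:R / L%:R by exact: signed_surv_even.
have px : signed_law f x = E^-1 * law M M 0 y * M r.
  by rewrite /signed_law /x law_cat_one law_zeros (hit_stationary_rev Est).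
have pxt : signed_law f (rcons x true) = E^-1 * law M M 0 y * (pair_share R (f i) / L%:R).
  rewrite /signed_law /x rcons_cat rcons_cons -cats1 law_cat_one (hit_stationary_rev Est).
  by rewrite law_cat_one hit_zeros add0n /= surv0 mulr1 signed_surv_mass.
have lawle : law (surv_avoiding i f) (surv_avoiding i f) 0 y <= law M M 0 y.
  apply: law_mono; first exact: signed_tail_survival.
    by move=> t; exact: signed_tail_le.
  by move=> t; exact: signed_mass_le.
have law0 : 0 <= law (surv_avoiding i f) (surv_avoiding i f) 0 y.
  by apply: law_ge0; exact: signed_tail_survival.
have [lawM0|lawM0] := eqVneq (law M M 0 y) 0.
  rewrite px lawM0 mulr0 !mul0r.
  have -> : law (surv_avoiding i f) (surv_avoiding i f) 0 y = 0.
    by apply/le_anti; rewrite law0 -lawM0 lawle.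
  by rewrite !mul0r.
have -> : signed_law f (rcons x true) / signed_law f x = pair_share R (f i) / (L - i)%:R.
  rewrite pxt px Mr; field.
  by rewrite (gt_eqF Li) (gt_eqF LR) (gt_eqF E0) lawM0.
rewrite [leLHS]mulrA ler_wpM2r ?sqr_ge0// px Mr natrM.
have -> : E^-1 * law M M 0 y * ((L - i)%:R / L%:R) = law M M 0 y / (E * L%:R) * (L - i)%:R.
  by field; rewrite (gt_eqF LR) (gt_eqF E0).
rewrite ler_wpM2r ?(ltW Li)//.
have KL0 : 0 <= (K%:R * L%:R)^-1 :> R by rewrite invr_ge0 mulr_ge0.
apply: ler_pM => //.
rewrite lef_pV2 ?posrE ?mulr_gt0// ?ler_wpM2r ?(ltW LR)//.
  exact: mean_time_le (surv0 f) (ssurv f).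
by rewrite (lt_le_trans E0 (mean_time_le _ (surv0 f) (ssurv f))).
Qed.

(** [rare] makes the expected number of gaps in a given pair during the window
at most one half. *)
Lemma sum_law_avoiding_ge f i k : (k < n)%N ->
  1 / 2 <= \sum_(y : k.-tuple bool) law (surv_avoiding i f) (surv_avoiding i f) 0 y.
Proof.
move=> kn; have LR : 0 < L%:R :> R by rewrite ltr0n.
pose theta : R := (m.+1%:R * L%:R)^-1.
apply: le_trans (@sum_law_defective_ge _ _ m theta _ _ _ k).
- have : theta * (k + m).+1%:R <= 1 / 2.
    rewrite /theta mulrC ler_pdivrMr ?mulr_gt0//.
    have : 2%:R * (k + m).+1%:R <= (m.+1 * L)%:R :> R.
      by rewrite -natrM ler_nat (leq_trans _ rare)//; lia.
    by rewrite -natrM; lra.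
  by lra.
- exact: signed_tail_survival.
- by rewrite invr_ge0 mulr_ge0.
- move=> r rm; rewrite /surv_avoiding signed_tail_below // cardC1 card_ord.
  rewrite /theta -subn1 natrB //.
  by field; rewrite (gt_eqF LR) nat1r pnatr_eq0.
Qed.

(** For each pair, pairing the signs [f] and [flip i f] forces an error
through [pair_share_separation]; the sum over pairs, averaged over all signs,
is attained by some choice of signs. *)
Lemma exists_hard_signs (q : seq bool -> R) :
  exists f, I%:R / (40 * K * L)%:R <= hellinger_risk (signed_law f) q n.
Proof.
pose G f x := signed_law f x *
   (Num.sqrt (signed_law f (rcons x true) / signed_law f x) - Num.sqrt (q x)) ^+ 2.
have G0 f x : 0 <= G f x.
  rewrite mulr_ge0 ?sqr_ge0 // law_ge0//.
  exact: equilibrium_survival (surv0 f) (ssurv f) (@survK f).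
pose w := widen_ord IL.
(* Pasts are written backwards: [y] is what precedes the last renewal. *)
pose X (i : 'I_I) (y : (n - (m + i.*2)).-1.-tuple bool) :=
  rev y ++ true :: nseq (m + i.*2) false.
pose phi (i : 'I_I) f := \sum_(y : (n - (m + i.*2)).-1.-tuple bool) G f (X i y).
have risk_ge f : \sum_(i < I) phi i f <= hellinger_risk (signed_law f) q n.
  rewrite /hellinger_risk -(sum_tuple_rev n (G f)).
  case: n ages @X @phi => [|n'] ag X phi.
    by rewrite big1 ?sumr_ge0// => i; have := ag i (ltn_ord i).
  rewrite (sum_tuple_first_one n' (fun x => G f (rev x))).
  rewrite -[leLHS]addr0 lerD ?G0//.
  pose H r := \sum_(y : (n' - r).-tuple bool) G f (rev (nseq r false ++ true :: y)).
  have -> : \sum_(i < I) phi i f = \sum_(i < I) H (Ordinal (ag i (ltn_ord i))).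
    apply: eq_bigr => i _; rewrite /phi /H /=.
    have -> : (n' - (m + i.*2) = (n'.+1 - (m + i.*2)).-1)%N by lia.
    by apply: eq_bigr => y _; rewrite /X rev_cat rev_cons cat_rcons rev_nseq.
  apply: ler_sum_inj => [i j [] ij|r]; last exact: sumr_ge0.
  by apply: val_inj => /=; lia.
have avg : \sum_(f : {ffun 'I_L -> bool}) (I%:R / (40 * K * L)%:R) <=
    \sum_(f : {ffun 'I_L -> bool}) hellinger_risk (signed_law f) q n.
  apply: (@le_trans _ _ (\sum_f \sum_(i < I) phi i f)); last first.
    by apply: ler_sum => f _; exact: risk_ge.
  rewrite exchange_big /=.
  apply: (@le_trans _ _
    (\sum_(i < I) \sum_(f : {ffun 'I_L -> bool}) (1 / (40 * K * L)%:R : R))).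
    rewrite exchange_big /=; apply: ler_sum => f _.
    by rewrite sumr_const card_ord -[leRHS]mulr_natl mul1r.
  apply: ler_sum => i _.
  rewrite -(ler_pM2l (ltr0n R 2)) [2 * \sum_f phi i f]mulr_natl mulr2n.
  rewrite [X in _ <= _ + X](reindex_inj (inv_inj (flipK (w i)))) /= -big_split mulr_sumr /=.
  apply: ler_sum => f _; rewrite /phi -big_split /=.
  have Li : 0 < (L - i)%:R :> R by rewrite ltr0n subn_gt0 (leq_trans (ltn_ord i)).
  have KL : 0 < (K * L)%:R :> R by rewrite ltr0n muln_gt0 L0 andbT /K; lia.
  have kn : ((n - (m + i.*2)).-1 < n)%N by have := ages (ltn_ord i); lia.
  apply: (@le_trans _ _ (\sum_(y : (n - (m + i.*2)).-1.-tuple bool)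
     law (surv_avoiding (w i) f) (surv_avoiding (w i) f) 0 y / (K * L)%:R * (1 / 10))).
    rewrite -!mulr_suml.
    have := sum_law_avoiding_ge f (w i) kn.
    set S := \sum_(_ : _) _ => S2.
    have -> : (40 * K * L)%:R = 40 * (K * L)%:R :> R by rewrite -mulnA natrM.
    move: KL; move: ((K * L)%:R : R) => kl kl0.
    have -> : 2 * (1 / (40 * kl)) = 1 / 2 / kl * (1 / 10) by field; rewrite (gt_eqF kl0).
    by rewrite ler_wpM2r ?divr_ge0// ler_wpM2r ?invr_ge0 ?(ltW kl0)//.
  apply: ler_sum => y _.
  have ef : law (surv_avoiding (w i) (flip (w i) f))
                (surv_avoiding (w i) (flip (w i) f)) 0 y =
            law (surv_avoiding (w i) f) (surv_avoiding (w i) f) 0 y.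
    by apply: eq_law; apply: signed_tail_eq => j;
     rewrite /= ffunE => /negbTE ->.
  apply: le_trans (lerD (hellinger_term_ge f (w i) y (q (X i y)))
                        (hellinger_term_ge (flip (w i) f) (w i) y (q (X i y)))).
  rewrite ef -mulrDr ler_wpM2l ?divr_ge0// ?law_ge0//; try exact: signed_tail_survival.
  have := @pair_share_separation (L - i)%:R^-1 (Num.sqrt (q (X i y))).
  rewrite invr_ge0 ltW// => /(_ isT) sep.
  rewrite -mulrDr -ler_pdivrMl// mulrCA mul1r; apply: le_trans sep _; rewrite ffunE eqxx /=.
  by case: (f (w i)) => //=; rewrite addrC.
have [/existsP//|/existsPn no] :=
  boolP [exists f, I%:R / (40 * K * L)%:R <= hellinger_risk (signed_law f) q n].
move: avg; rewrite leNgt ltr_sum//.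
  by apply/hasP; exists [ffun=> true]; rewrite ?mem_index_enum.
by move=> f _; rewrite ltNge no.
Qed.

End Family.
End Hellinger.

(** * Counting partitions *)

Section Partitions.
Variable R : realType.

Lemma geometric_le (y : R) n : 0 <= y < 1 -> \sum_(c < n) y ^+ c <= (1 - y)^-1.
Proof.
move=> /andP[y0 y1]; have d0 : 0 < 1 - y by lra.
rewrite -[leRHS]mul1r ler_pdivlMr// mulrC -opprB mulNr -subrX1 opprB.
by rewrite gerBl exprn_ge0.
Qed.

(** Partitions of the integers at most [n], encoded by the number [c j] of
parts equal to [j + 1]. *)
Definition multiplicities n : {set {ffun 'I_n -> 'I_n.+1}} :=
  [set c : {ffun 'I_n -> 'I_n.+1} | (\sum_(j < n) j.+1 * c j <= n)%N].

(** Each partition of an integer at most [n] contributes at least [x ^+ n] to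
the expanded product of geometric series. *)
Lemma card_multiplicities_gf n (x : R) : 0 < x < 1 ->
  #|multiplicities n|%:R * x ^+ n <= \prod_(j < n) (1 - x ^+ j.+1)^-1.
Proof.
move=> /andP[x0 x1].
apply: (@le_trans _ _ (\prod_(j < n) \sum_(c < n.+1) (x ^+ j.+1) ^+ c)); last first.
  apply: ler_prod => j _; rewrite sumr_ge0 => [|c _]; last by rewrite !exprn_ge0// ltW.
  by rewrite geometric_le // exprn_ge0 ?ltW //= exprn_ilt1 // ltW.
rewrite bigA_distr_bigA /= mulr_natl -sumr_const.
rewrite [leRHS](bigID (mem (multiplicities n)))/= -[leLHS]addr0 lerD//; last first.
  by apply: sumr_ge0 => c _; apply: prodr_ge0 => j _; rewrite !exprn_ge0// ltW.
apply: ler_sum => c; rewrite inE => cn.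
rewrite (eq_bigr (fun j : 'I_n => x ^+ (j.+1 * c j))) => [|j _]; last by rewrite exprM.
by rewrite prodrXr ler_wiXn2l // ltW.
Qed.

(** With [1 + u] in place of [1 / x], keeping three terms of the binomial
expansion gives [(1 + u) ^+ j - 1 >= (j * u) ^+ 2 / 2]. The quadratic decay in
[j] is what makes the product of the factors [exp (O (k))] instead of
[exp (O (k * ln k))]. *)
Lemma gf_factor_le (k j : nat) : (0 < k)%N ->
  (1 - ((1 + k%:R^-1)^-1) ^+ j.+1)^-1 <= 1 + 2 * k%:R ^+ 2 / j.+1%:R ^+ 2 :> R.
Proof.
move=> k0; set u : R := k%:R^-1.
have u0 : 0 < u by rewrite invr_gt0 ltr0n.
have u1 : u <= 1 by rewrite invf_le1 ?ltr0n // ler1n.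
have H i : 1 + i%:R * u + i%:R * (i%:R - 1) / 2 * u ^+ 2 <= (1 + u) ^+ i.
  elim: i => [|i IHi]; first by rewrite expr0 !mul0r !addr0.
  have up : 0 <= 1 + u by lra.
  rewrite [leRHS]exprSr; have := ler_wpM2r up IHi; apply: le_trans.
  have h : 0 <= i%:R * (i%:R - 1) / 2 * u ^+ 2 * u.
    case: i {IHi} => [|i]; first by rewrite !mul0r.
    by rewrite -natr1 addrK !mulr_ge0 ?exprn_ge0 ?addr_ge0 ?invr_ge0 ?(ltW u0)//.
  rewrite -natr1; rewrite -subr_ge0; apply: le_trans h _; rewrite le_eqVlt; apply/orP; left.
  by apply/eqP; field.
set i := j.+1; have i1 : 1 <= i%:R :> R by rewrite ler1n.
have Hi : i%:R ^+ 2 * u ^+ 2 / 2 <= (1 + u) ^+ i - 1.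
  have := H i; have : 0 <= i%:R * u * (1 - u) by rewrite !mulr_ge0 ?subr_ge0// ltW.
  nra.
have p0 : 0 < i%:R ^+ 2 * u ^+ 2 / 2 by rewrite divr_gt0 // mulr_gt0 // exprn_gt0 // ltr0n.
set y := (1 + u) ^+ i in Hi; have y1 : 0 < y - 1 by lra.
have y0 : 0 < y by lra.
have -> : (1 - (1 + u)^-1 ^+ i)^-1 = 1 + (y - 1)^-1.
  rewrite exprVn -/y; have -> : 1 - y^-1 = (y - 1) / y by field; rewrite gt_eqF.
  by rewrite invf_div; field; rewrite (gt_eqF y1).
rewrite lerD2l.
have -> : 2 * k%:R ^+ 2 / i%:R ^+ 2 = (i%:R ^+ 2 * u ^+ 2 / 2)^-1.
  by rewrite /u; field; rewrite pnatr_eq0 -lt0n k0 /= gt_eqF // (lt_le_trans ltr01).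
by rewrite lef_pV2 ?posrE.
Qed.

(** Each factor is at most [3 * (k / j) ^+ 2], and [k ^ k / k!] is one term of
the exponential series at [k]. *)
Lemma prod_small_le (k : nat) :
  \prod_(j < k) (1 + 2 * k%:R ^+ 2 / j.+1%:R ^+ 2) <= expR (4 * k%:R) :> R.
Proof.
apply: (@le_trans _ _ (\prod_(j < k) (3 * (k%:R / j.+1%:R) ^+ 2))).
  apply: ler_prod => j _; have h : 1 <= (k%:R / j.+1%:R : R) ^+ 2.
    by rewrite exprn_ege1 // ler_pdivlMr ?ltr0n// mul1r ler_nat.
  rewrite -mulrA -expr_div_n; move: ((k%:R / j.+1%:R : R) ^+ 2) h => q h.
  by apply/andP; split; lra.
rewrite big_split /= prodr_const card_ord prodrXl prodf_div prodr_const card_ord.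
rewrite -natr_prod -(big_mkord xpredT S) -(big_add1 _ _ 0 k.+1 xpredT id) -fact_prod.
have -> : 4 * k%:R = k%:R * 2 + (k%:R + k%:R) :> R by ring.
rewrite expRD expRM_natl ler_pM ?exprn_ge0 ?divr_ge0//.
  by rewrite lerXn2r ?nnegrE ?expR_ge0//; have := expR_ge1Dx (2 : R); lra.
rewrite expRD -expr2 lerXn2r ?nnegrE ?expR_ge0 ?divr_ge0 ?exprn_ge0//.
case: k => [|k]; first by rewrite expr0 divr1 expR0.
by apply: le_trans (expR_ge1Dxn k (ler0n R k.+1)); rewrite lerDr.
Qed.

(** Beyond [k], [ln (1 + 2 k^2 / j^2)] is dominated by a telescoping
difference. *)
Lemma prod_gf_le (k n : nat) : (0 < k)%N ->
  \prod_(j < n) (1 + 2 * k%:R ^+ 2 / j.+1%:R ^+ 2) <= expR (6 * k%:R) :> R.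
Proof.
move=> k0; have kR : 0 < k%:R :> R by rewrite ltr0n.
have step j : (0 < j)%N -> 1 + 2 * k%:R ^+ 2 / j.+1%:R ^+ 2 <=
    expR (2 * k%:R ^+ 2 / j%:R - 2 * k%:R ^+ 2 / j.+1%:R) :> R.
  move=> j0; apply: le_trans (expR_ge1Dx _); rewrite lerD2l -mulrBr ler_wpM2l//.
  have jR : 0 < j%:R :> R by rewrite ltr0n.
  have jR1 : 0 < j.+1%:R :> R by rewrite ltr0n.
  have -> : j%:R^-1 - j.+1%:R^-1 = (j%:R * j.+1%:R)^-1 :> R.
    by rewrite -natr1 in jR1 *; field; rewrite !gt_eqF.
  by rewrite lef_pV2 ?posrE ?exprn_gt0 ?mulr_gt0// expr2 ler_wpM2r ?ler_nat ?ltW.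
(* [1 / (j + 1)^2] is at most [1 / j - 1 / (j + 1)]. *)
have tail i : \prod_(j < k + i) (1 + 2 * k%:R ^+ 2 / j.+1%:R ^+ 2) <=
    expR (4 * k%:R + (2 * k%:R - 2 * k%:R ^+ 2 / (k + i)%:R)) :> R.
  elim: i => [|i IHi].
    rewrite addn0 (_ : 2 * k%:R - _ = 0) ?addr0 ?prod_small_le//.
    by field; rewrite gt_eqF.
  rewrite addnS big_ord_recr /=.
  have ki : (0 < k + i)%N by rewrite addn_gt0 k0.
  apply: le_trans (ler_pM _ _ IHi (step _ ki)) _.
  - by apply: prodr_ge0 => j _; rewrite addr_ge0 // divr_ge0 // ?mulr_ge0 ?exprn_ge0.
  - by rewrite addr_ge0 // divr_ge0 // ?mulr_ge0 ?exprn_ge0.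
  by rewrite -expRD ler_expR -addrA [_ - _ + (_ - _)]addrA subrK.
apply: (@le_trans _ _ (\prod_(j < k + n) (1 + 2 * k%:R ^+ 2 / j.+1%:R ^+ 2))).
  rewrite addnC big_split_ord /= ler_peMr//.
    by apply: prodr_ge0 => j _; rewrite addr_ge0 // divr_ge0 // ?mulr_ge0 ?exprn_ge0.
  elim/big_ind: _ => // [a b a1 b1|j _]; first exact: mulr_ege1.
  by rewrite lerDl divr_ge0 // ?mulr_ge0 ?exprn_ge0.
apply: le_trans (tail n) _; rewrite ler_expR.
have : 0 <= 2 * k%:R ^+ 2 / (k + n)%:R :> R by rewrite divr_ge0 // ?mulr_ge0 ?exprn_ge0.
by lra.
Qed.

(** The generating function at [x = (1 + 1 / k)^-1], with [k] of order
[sqrt n]. *)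
Lemma card_multiplicities_le (k n : nat) : (0 < k)%N -> (n <= k ^ 2)%N ->
  #|multiplicities n|%:R <= expR (7 * k%:R) :> R.
Proof.
move=> k0 nk; have kR : 0 < k%:R :> R by rewrite ltr0n.
pose x : R := (1 + k%:R^-1)^-1.
have k1 : 0 < 1 + k%:R^-1 :> R by rewrite addr_gt0 ?invr_gt0.
have x01 : 0 < x < 1.
  by rewrite invr_gt0 k1 /= invf_lt1 // ltrDl invr_gt0.
have := card_multiplicities_gf n x01.
have -> : x ^+ n = ((1 + k%:R^-1) ^+ n)^-1 by rewrite exprVn.
rewrite ler_pdivrMr ?exprn_gt0// => H; apply: le_trans H _.
have -> : 7 * k%:R = 6 * k%:R + k%:R :> R by ring.
rewrite expRD ler_pM//.
- by apply: prodr_ge0 => j _; rewrite invr_ge0 subr_ge0 exprn_ile1 // ltW //; case/andP: x01.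
- apply: le_trans (prod_gf_le n k0); apply: ler_prod => j _.
  rewrite gf_factor_le // andbT invr_ge0 subr_ge0 exprn_ile1 // ltW //; by case/andP: x01.
apply: (@le_trans _ _ (expR (k%:R^-1) ^+ n)).
  by rewrite lerXn2r ?nnegrE ?expR_ge0 ?expR_ge1Dx// ltW.
rewrite -expRM_natr ler_expR mulrC ler_pdivrMr// -expr2 -natrX ler_nat.
exact: nk.
Qed.

End Partitions.

(** * Classes of strings with the same gaps *)

Section Types.
Implicit Types (x z : seq bool) (r : nat).

Fixpoint gaps r x : seq nat :=
  match x with
  | [::] => [::]
  | b :: y => if b then r.+1 :: gaps 0 y else gaps r.+1 y
  end.

Fixpoint age r x : nat :=
  match x with
  | [::] => r
  | b :: y => if b then age 0 y else age r.+1 y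
  end.

Definition after_first z := drop (index true z).+1 z.

Lemma law_gaps (R : comNzRingType) (M : nat -> R) r x :
  law M M r x = (\prod_(g <- gaps r x) (M g.-1 - M g)) * M (age r x).
Proof.
elim: x r => [|[] x IHx] r /=; first by rewrite big_nil mul1r.
  by rewrite big_cons IHx mulrA.
exact: IHx.
Qed.

Lemma sum_gaps r x : (sumn (gaps r x) + age r x = r + size x)%N.
Proof. by elim: x r => [|[] x IHx] r /=; rewrite ?addn0// -?addnA IHx; lia. Qed.

Lemma gaps_gt0 r x g : g \in gaps r x -> (0 < g)%N.
Proof. by elim: x r => [|[] x IHx] r //=; [rewrite inE => /orP[/eqP->|/IHx]|exact: IHx]. Qed.

Lemma leq_sumn (s : seq nat) g : g \in s -> (g <= sumn s)%N.
Proof.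
elim: s => //= a s IHs; rewrite inE => /orP[/eqP->|/IHs]; first exact: leq_addr.
by move=> h; apply: leq_trans h (leq_addl _ _).
Qed.

Lemma count_gaps_le (s : seq nat) g : (g.+1 * count_mem g.+1 s <= sumn s)%N.
Proof.
elim: s => [|a s IHs] /=; rewrite ?muln0// mulnDr leq_add//.
by case: eqP => [->|]; rewrite ?muln1 ?muln0.
Qed.

Lemma sumn_counts n (s : seq nat) : (forall g, g \in s -> 0 < g <= n)%N ->
  (\sum_(j < n) j.+1 * count_mem j.+1 s = sumn s)%N.
Proof.
elim: s => [|a s IHs] sn /=; first by rewrite big1 // => j _; rewrite muln0.
rewrite -IHs => [|g gs]; last by apply: sn; rewrite inE gs orbT.
under eq_bigr do rewrite mulnDr; rewrite big_split /=; congr addn.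
have /andP[a0 an] := sn a (mem_head _ _).
have an' : (a.-1 < n)%N by lia.
rewrite (bigD1 (Ordinal an'))//= prednK// eqxx muln1 big1 ?addn0// => j ja.
by case: eqP => [aj|]; rewrite ?muln0//; move: ja; rewrite -val_eqE /= aj eqxx.
Qed.

Variable n : nat.

(** The data that determine the probability of a string: the position of the
first renewal, the last age, and the multiset of gaps as a table of
multiplicities. The [inord] are harmless because all these numbers are at most
[n]. *)
Definition string_type (z : n.-tuple bool) :
    'I_n.+1 * 'I_n.+1 * {ffun 'I_n -> 'I_n.+1} :=
  (inord (index true z), inord (age 0 (after_first z)),
   [ffun j : 'I_n => inord (count_mem j.+1 (gaps 0 (after_first z)))]).

Lemma size_after_first z : (size (after_first z) <= size z)%N.
Proof. by rewrite size_drop leq_subr. Qed.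

Lemma sumn_gaps_le z : (sumn (gaps 0 (after_first z)) <= size z)%N.
Proof. by have := sum_gaps 0 (after_first z); have := size_after_first z; lia. Qed.

Lemma gaps_bound z g : g \in gaps 0 (after_first z) -> (0 < g <= size z)%N.
Proof.
by move=> gg; rewrite (gaps_gt0 gg) (leq_trans (leq_sumn gg))// sumn_gaps_le.
Qed.

Lemma count_bound z j : (count_mem j.+1 (gaps 0 (after_first z)) <= size z)%N.
Proof.
have := count_gaps_le (gaps 0 (after_first z)) j; have := sumn_gaps_le z.
move: (count_mem _ _) => c; nia.
Qed.

Lemma string_type_multiplicities (z : n.-tuple bool) : (string_type z).2 \in multiplicities n.
Proof.
rewrite inE /= (eq_bigr (fun j : 'I_n => (j.+1 * count_mem j.+1 (gaps 0 (after_first z)))%N)).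
  rewrite sumn_counts; first by have := sumn_gaps_le z; rewrite size_tuple.
  by move=> g /gaps_bound; rewrite size_tuple.
move=> j _; rewrite ffunE inordK // ltnS.
by have := count_bound z j; rewrite size_tuple.
Qed.

Lemma index_string_type (z z' : n.-tuple bool) : string_type z = string_type z' ->
  index true z = index true z'.
Proof.
move=> /(congr1 (fun t => val t.1.1))/=.
have lt (y : n.-tuple bool) : (index true y < n.+1)%N.
  by rewrite ltnS -[X in (_ <= X)%N](size_tuple y) index_size.
by rewrite !inordK ?lt.
Qed.

Lemma law_string_type (R : comNzRingType) (M : nat -> R) (z z' : n.-tuple bool) :
  string_type z = string_type z' ->
  law M M 0 (after_first z) = law M M 0 (after_first z').
Proof.
move=> e; rewrite !law_gaps.
have age_lt (y : n.-tuple bool) : (age 0 (after_first y) < n.+1)%N.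
  have := sum_gaps 0 (after_first y); have := size_after_first y.
  by rewrite size_tuple; lia.
congr (_ * M _); last first.
  by move: (congr1 (fun t => val t.1.2) e); rewrite /= !inordK.
apply: perm_big; apply/allP => g; rewrite mem_cat => gzz /=.
have {gzz} : (0 < g <= n)%N by case/orP: gzz => /gaps_bound; rewrite size_tuple.
case: g => // j jn.
move: (congr1 (fun t : _ * {ffun 'I_n -> 'I_n.+1} => val (t.2 (Ordinal jn))) e).
rewrite /= !ffunE.
have lt (y : n.-tuple bool) : (count_mem j.+1 (gaps 0 (after_first y)) < n.+1)%N.
  by rewrite ltnS; have := count_bound y j; rewrite size_tuple.
by rewrite !inordK ?lt// => ->.
Qed.

Section Weights.
Variable R : realType.

(** Uniform distribution on each class of strings of the same type; at other
lengths than [n], any positive value would do. *)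
Definition type_weight (z : seq bool) : R :=
  if insub z is Some t then
    #|[set z' | string_type z' == string_type t]|%:R^-1 else 1.

Lemma type_weightE (z : n.-tuple bool) :
  type_weight z = #|[set z' | string_type z' == string_type z]|%:R^-1.
Proof. by rewrite /type_weight valK. Qed.

Lemma type_class_gt0 (z : n.-tuple bool) :
  (0 < #|[set z' | string_type z' == string_type z]|)%N.
Proof. by apply/card_gt0P; exists z; rewrite inE. Qed.

Lemma type_weight_gt0 z : 0 < type_weight z.
Proof.
by rewrite /type_weight; case: insubP => // t _ _; rewrite invr_gt0 ltr0n type_class_gt0.
Qed.

(** A deterministic delay [i + 1] selects the strings whose first renewal is
at position [i]; the survival function of such a delay is [t |-> (t <= i)]. *)
Lemma law_delta (M : nat -> R) i r z : M 0 = 1 -> (i <= r + size z)%N ->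
  law (fun t => (t <= i)%N%:R) M r z =
  (r + index true z == i)%N%:R * law M M 0 (after_first z).
Proof.
move=> M0; elim: z r => [|[] z IHz] r /=; rewrite ?addn0 => ir.
- by rewrite M0 mulr1; case: ltngtP ir.
- rewrite /after_first /= drop0; congr (_ * _).
  by case: ltngtP => _; rewrite ?subr0 ?subrr.
- by rewrite IHz addSnnS.
Qed.

(** The probability after the first renewal is constant on the class of [z],
and its sum over the class is at most 1. *)
Lemma law_le_type_weight (M : nat -> R) (z : n.-tuple bool) :
  survival M -> M 0 = 1 -> law M M 0 (after_first z) <= type_weight z.
Proof.
move=> sM M0; rewrite type_weightE -[leRHS]mul1r ler_pdivlMr ?ltr0n ?type_class_gt0//.
set i := index true z.
have iz : (i <= n)%N by rewrite -[X in (_ <= X)%N](size_tuple z) index_size.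
apply: (@le_trans _ _ (\sum_(z' : n.-tuple bool) law (fun t => (t <= i)%N%:R) M 0 z')).
  rewrite mulr_natr -sumr_const.
  rewrite [leRHS](bigID (mem [set z' | string_type z' == string_type z]))/=.
  rewrite -[leLHS]addr0 lerD//.
    apply: ler_sum => z'; rewrite inE => /eqP zz.
    rewrite law_delta ?size_tuple// (index_string_type zz) eqxx mul1r.
    by rewrite (law_string_type M zz).
  by apply: sumr_ge0 => z' _; rewrite law_delta ?size_tuple// mulr_ge0 // law_ge0.
by rewrite sum_law.
Qed.

(** The total weight is the number of types that occur. *)
Lemma sum_type_weight_le :
  \sum_(z : n.-tuple bool) type_weight z <= (n.+1 ^ 2 * #|multiplicities n|)%:R.
Proof.
pose T := [set t : 'I_n.+1 * 'I_n.+1 * {ffun 'I_n -> 'I_n.+1} | t.2 \in multiplicities n].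
have cardT : #|T| = (n.+1 ^ 2 * #|multiplicities n|)%N.
  have <- : #|finset.setX [set: 'I_n.+1 * 'I_n.+1] (multiplicities n)| =
      (n.+1 ^ 2 * #|multiplicities n|)%N.
    by rewrite cardsX cardsT card_prod card_ord.
  by apply: eq_card => -[a b]; rewrite !inE.
rewrite -cardT (partition_big string_type (mem T)) /= => [|z _]; last first.
  by have := string_type_multiplicities z; rewrite !inE.
rewrite -sum1_card natr_sum; apply: ler_sum => t _.
have [z0 /eqP z0t|no] := pickP (fun z : n.-tuple bool => string_type z == t);
  last by rewrite big_pred0 ?ler01.
rewrite (eq_bigr (fun=> #|[set z' | string_type z' == t]|%:R^-1)) => [|z /eqP zt]; last first.
  by rewrite type_weightE zt.
rewrite (eq_bigl (mem [set z' | string_type z' == t])) => [|z]; last by rewrite !inE.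
rewrite sumr_const -[leLHS]mulr_natr mulVf // pnatr_eq0 -lt0n.
by rewrite -z0t type_class_gt0.
Qed.

End Weights.
End Types.

(** * From a dominating weight to a predictor *)

Section FiniteRisk.
Variables (R : realType) (n : nat) (p : seq bool -> R).
Hypotheses (p0 : forall x, 0 <= p x).
Hypothesis pS : forall x, \sum_(b : bool) p (rcons x b) = p x.

Lemma prob_rcons_le x b : p (rcons x b) <= p x.
Proof. by rewrite -[leRHS]pS big_bool; case: b; rewrite ?lerDl ?lerDr p0. Qed.

Lemma past_marginalE (x : n.-tuple bool) :
  past_marginal (fun z : n.+1.-tuple bool => p z) x = p x.
Proof. exact: pS. Qed.

Lemma next_given_pastE (x : n.-tuple bool) b :
  next_given_past (fun z : n.+1.-tuple bool => p z) x b = p (rcons x b) / p x.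
Proof. by rewrite /next_given_past past_marginalE. Qed.

(** For a positive estimator the divergences are finite and the risk is an
expectation of log-likelihood ratios. Pasts of probability zero contribute zero
on both sides. *)
Lemma prediction_risk_fin (Q : n.-tuple bool -> bool -> R) :
  (forall x b, 0 < Q x b) ->
  prediction_risk (fun z : n.+1.-tuple bool => p z) Q =
  (\sum_(x : n.-tuple bool) \sum_(b : bool)
     p (rcons x b) * (ln (p (rcons x b) / p x) - ln (Q x b)))%:E.
Proof.
move=> Q0; rewrite /prediction_risk -sumEFin; apply: eq_bigr => x _.
rewrite past_marginalE.
have [px0|px0] := eqVneq (p x) 0.
  have pxb0 b : p (rcons x b) = 0 by apply/le_anti; rewrite p0 -px0 prob_rcons_le.
  by rewrite px0 mul0e big1 // => b _; rewrite pxb0 mul0r.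
have px : 0 < p x by rewrite lt0r px0 p0.
rewrite /kl_div (eq_bigr (fun b : bool =>
   (p (rcons x b) / p x * (ln (p (rcons x b) / p x) - ln (Q x b)))%:E)) => [|b _].
  rewrite sumEFin -EFinM mulr_sumr; congr EFin; apply: eq_bigr => b _.
  by rewrite mulrA mulrCA divff // mulr1.
rewrite next_given_pastE (gt_eqF (Q0 x b)).
have [pxb|pxb] := eqVneq (p (rcons x b) / p x) 0; first by rewrite pxb mul0r.
have h : 0 < p (rcons x b) / p x by rewrite lt0r pxb divr_ge0.
by congr (_ * _)%:E; rewrite [LHS]ln_div ?posrE.
Qed.

End FiniteRisk.

Section Compression.
Variable R : realType.

(** Concavity of the logarithm, in the form used to prove Jensen
inequalities. *)
Lemma ln_le_tangent (x c : R) : 0 < x -> 0 < c -> ln x <= ln c + (x / c - 1).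
Proof.
move=> x0 c0; have xc : 0 < x / c by rewrite divr_gt0.
have -> : ln x = ln c + ln (x / c) by rewrite ln_div //; lra.
have h : -1 < x / c - 1 by lra.
by rewrite lerD2l; have := le_ln1Dx h; rewrite addrC subrK.
Qed.

Lemma ln_mean_ge n (q : 'I_n.+1 -> R) : (forall i, 0 < q i) ->
  n.+1%:R^-1 * \sum_i ln (q i) <= ln (n.+1%:R^-1 * \sum_i q i).
Proof.
move=> q0; set c := (X in _ <= ln X).
have n0 : 0 < n.+1%:R :> R by rewrite ltr0n.
have S0 : 0 < \sum_i q i.
  by rewrite big_ord_recl ltr_pwDl // sumr_ge0 // => i _; apply: ltW.
have c0 : 0 < c by rewrite mulr_gt0 ?invr_gt0.
rewrite ler_pdivrMl//.
apply: (@le_trans _ _ (\sum_i (ln c + (q i / c - 1)))).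
  by apply: ler_sum => i _; exact: ln_le_tangent.
rewrite big_split /= sumrB -mulr_suml !sumr_const card_ord.
have -> : (\sum_i q i) / c = n.+1%:R.
  by rewrite /c; field; rewrite (gt_eqF S0) nat1r pnatr_eq0.
by rewrite subrr addr0 -[leLHS]mulr_natl.
Qed.

Variables (n : nat) (W : seq bool -> R).
Hypothesis W0 : forall z, 0 < W z.

(** Unnormalised marginals of [W]; their ratios are conditional
probabilities. *)
Definition prefix_weight k y : R := \sum_(u : k.-tuple bool) W (y ++ u).

Lemma prefix_weight_rcons k y :
  prefix_weight k.+1 y = \sum_(b : bool) prefix_weight k (rcons y b).
Proof.
rewrite /prefix_weight (sum_tuple_cons k (fun u => W (y ++ u))) exchange_big.
by apply: eq_bigr => b _; apply: eq_bigr => u _; rewrite cat_rcons.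
Qed.

Lemma prefix_weight_gt0 k y : 0 < prefix_weight k y.
Proof.
rewrite /prefix_weight (bigD1 [tuple of nseq k false])//= ltr_pwDl// sumr_ge0 // => u _.
exact: ltW.
Qed.

(** Conditional weight of the next symbol when the first [s] symbols of the
past are forgotten. *)
Definition suffix_predictor s x b : R :=
  prefix_weight s (rcons (drop s x) b) / prefix_weight s.+1 (drop s x).

(** Each amount of forgotten past is used once, so that by stationarity the
losses of the predictors add up to the loss of one sequential prediction. *)
Definition averaged_predictor (x : n.-tuple bool) b : R :=
  n.+1%:R^-1 * \sum_(s < n.+1) suffix_predictor s x b.

Lemma suffix_predictor_gt0 s x b : 0 < suffix_predictor s x b.
Proof. by rewrite divr_gt0 // prefix_weight_gt0. Qed.

Lemma averaged_predictor_gt0 x b : 0 < averaged_predictor x b.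
Proof.
rewrite mulr_gt0 ?invr_gt0 ?ltr0n// big_ord_recl ltr_pwDl ?suffix_predictor_gt0//.
by apply: sumr_ge0 => s _; rewrite ltW // suffix_predictor_gt0.
Qed.

Lemma averaged_predictor_pmf x : is_pmf (averaged_predictor x).
Proof.
split=> [b|]; first by rewrite ltW // averaged_predictor_gt0.
rewrite -mulr_sumr exchange_big /= (eq_bigr (fun=> 1)) => [|s _].
  by rewrite sumr_const card_ord mulVf // pnatr_eq0.
by rewrite -mulr_suml -prefix_weight_rcons divff // gt_eqF // prefix_weight_gt0.
Qed.

Section Stationary.
Variable p : seq bool -> R.
Hypothesis pS : forall x, \sum_(b : bool) p (rcons x b) = p x.
Hypothesis Sp : forall x, \sum_(b : bool) p (b :: x) = p x.

Lemma sum_drop s m (F : seq bool -> R) :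
  \sum_(z : (s + m).-tuple bool) p z * F (drop s z) = \sum_(y : m.-tuple bool) p y * F y.
Proof.
elim: s => [|s IHs]; first by apply: eq_bigr => y _; rewrite drop0.
rewrite -IHs (sum_tuple_cons (s + m) (fun z => p z * F (drop s.+1 z))).
by apply: eq_bigr => z _ /=; rewrite -mulr_suml Sp.
Qed.

Lemma sum_take s m (F : seq bool -> R) :
  \sum_(z : (m + s).-tuple bool) p z * F (take m z) = \sum_(y : m.-tuple bool) p y * F y.
Proof.
elim: s => [|s IHs].
  rewrite addn0; apply: eq_bigr => y _; congr (_ * F _).
  by rewrite -[X in take X _](size_tuple y) take_size.
rewrite -IHs addnS (sum_tuple_rcons (m + s) (fun z => p z * F (take m z))).
apply: eq_bigr => z _; rewrite -[in RHS]pS mulr_suml; apply: eq_bigr => b _.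
by rewrite -cats1 takel_cat // size_tuple leq_addr.
Qed.

End Stationary.

Section RenewalRisk.
Variables A M : nat -> R.
Hypotheses (sA : survival A) (sM : survival M) (A0 : A 0 = 1) (M0 : M 0 = 1).
Hypothesis stat : forall x, \sum_(b : bool) law A M 0 (b :: x) = law A M 0 x.
Let p := law A M 0.
Let p0 x : 0 <= p x. Proof. exact: law_ge0. Qed.
Let pS x : \sum_(b : bool) p (rcons x b) = p x. Proof. exact: law_rcons. Qed.

(** Log-probability of a string given the position of its first renewal. *)
Definition log_law x := ln (law M M 0 (after_first x)).

Lemma after_first_zeros k : after_first (nseq k false) = [::].
Proof.
by rewrite /after_first memNindex ?drop_oversize ?leqnSn // mem_nseq andbF.
Qed.

Lemma has_one_or_zeros x :
  x = nseq (size x) false \/ exists i v, x = nseq i false ++ true :: v.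
Proof.
elim: x => [|[] x [IHx|[i [v IHx]]]]; first by left.
- by right; exists 0%N, x.
- by right; exists 0%N, x.
- by left; rewrite /= {1}IHx.
- by right; exists i.+1, v; rewrite IHx.
Qed.

Lemma after_first_cat i v : after_first (nseq i false ++ true :: v) = v.
Proof. by rewrite /after_first; elim: i => [|i IHi] //=; rewrite drop0. Qed.

Lemma after_first_rcons_zeros k b : after_first (rcons (nseq k false) b) = [::].
Proof.
case: b; first by rewrite -cats1 after_first_cat.
by rewrite -(after_first_zeros k.+1); congr after_first; elim: k => //= k ->.
Qed.

Lemma law_after_first_gt0 x : 0 < p x -> 0 < law M M 0 (after_first x).
Proof.
have [->|[i [v ->]]] := has_one_or_zeros x; first by rewrite after_first_zeros /= M0.
rewrite after_first_cat /p law_cat_one lt0r => /andP[/eqP nz _].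
by rewrite lt0r law_ge0 // andbT; apply/eqP => h; apply: nz; rewrite h mulr0.
Qed.

(** If the suffix contains a renewal, the conditional probability of the next
symbol is determined by what follows this renewal; otherwise the right-hand
side is zero. *)
Lemma ln_cond_le s x b : 0 < p (rcons x b) ->
  ln (p (rcons x b) / p x) <= log_law (rcons (drop s x) b) - log_law (drop s x).
Proof.
move=> pz; have px : 0 < p x by rewrite (lt_le_trans pz)// prob_rcons_le.
have [dE|[i [v dE]]] := has_one_or_zeros (drop s x).
  rewrite /log_law {}dE after_first_rcons_zeros after_first_zeros subrr.
  by rewrite ln_le0 // ler_pdivrMr// mul1r prob_rcons_le.
rewrite /log_law dE rcons_cat rcons_cons !after_first_cat.
have xE : x = (take s x ++ nseq i false) ++ true :: v by rewrite -catA -dE cat_take_drop.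
move: pz px; rewrite xE rcons_cat rcons_cons /p !law_cat_one.
set h := hit _ _ _ _ => pz px.
have h0 : 0 < h.
  by rewrite lt0r hit_ge0 // andbT; apply: contraTneq pz => ->; rewrite mul0r ltxx.
move: pz px; rewrite !pmulr_rgt0// => pz px.
by rewrite -mulf_div divff ?gt_eqF// mul1r ln_div.
Qed.

Hypothesis lawW : forall z : n.+1.-tuple bool, law M M 0 (after_first z) <= W z.

(** The increments [phi s] compare the log-loss of the predictor that forgets
[s] symbols with the true conditional law. Shift invariance turns their
expectations into expectations over prefixes of one string, where they
telescope to [log_law z - ln (W z)] plus the logarithm of the total mass. *)
Lemma prediction_risk_le :
  (prediction_risk (fun z : n.+1.-tuple bool => p z) averaged_predictor <=
   (ln (\sum_(z : n.+1.-tuple bool) W z) / n.+1%:R)%:E)%E.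
Proof.
rewrite (prediction_risk_fin p0 pS averaged_predictor_gt0) lee_fin.
(* The potential whose increments are the losses of the sequential prediction. *)
pose G t z := log_law (take t z) - ln (prefix_weight (n.+1 - t) (take t z)).
pose phi s y := (log_law y - log_law (take (n - s) y)) -
  (ln (prefix_weight s y) - ln (prefix_weight s.+1 (take (n - s) y))).
pose S := \sum_(s < n.+1) \sum_(z : n.+1.-tuple bool) p z * phi s (drop s z).
have n0 : 0 < n.+1%:R :> R by rewrite ltr0n.
apply: (@le_trans _ _ (n.+1%:R^-1 * S)).
  rewrite /S [X in _ <= _ * X]exchange_big /=.
  rewrite (sum_tuple_rcons n (fun z => \sum_(s < n.+1) p z * phi s (drop s z))). 
  rewrite mulr_sumr; apply: ler_sum => x _; rewrite mulr_sumr; apply: ler_sum => b _.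
  rewrite -mulr_sumr mulrCA.
  have [pz|pz] := eqVneq (p (rcons x b)) 0; first by rewrite pz !mul0r.
  have {}pz : 0 < p (rcons x b) by rewrite lt0r pz p0.
  rewrite ler_wpM2l// ?(ltW pz)//.
  apply: (@le_trans _ _ (ln (p (rcons x b) / p x) -
      n.+1%:R^-1 * \sum_(s < n.+1) ln (suffix_predictor s x b))).
    rewrite lerD2l lerN2; apply: ln_mean_ge => s; exact: suffix_predictor_gt0.
  have n1 : n.+1%:R != 0 :> R by rewrite gt_eqF.
  rewrite -(ler_pM2l n0) mulrBr !(mulVKf n1).
  rewrite mulr_natl -[X in _ *+ X](card_ord n.+1) -sumr_const -sumrB.
  apply: ler_sum => s _.
  have sn : (s <= n)%N by rewrite -ltnS.
  have dz : drop s (rcons x b) = rcons (drop s x) b by rewrite drop_rcons ?size_tuple.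
  have tz : take (n - s) (rcons (drop s x) b) = drop s x.
    by rewrite -cats1 takel_cat ?size_drop ?size_tuple// take_oversize // size_drop size_tuple.
  rewrite /phi dz tz /suffix_predictor ln_div ?posrE ?prefix_weight_gt0// lerD2r.
  exact: ln_cond_le.
have SE : S = \sum_(z : n.+1.-tuple bool) p z * \sum_(s < n.+1) phi s (take (n.+1 - s) z).
  rewrite /S; under [RHS]eq_bigr do rewrite mulr_sumr.
  rewrite [RHS]exchange_big; apply: eq_bigr => s _ /=.
  have sn : (s <= n.+1)%N by apply: ltnW.
  transitivity (\sum_(y : (n.+1 - s).-tuple bool) p y * phi s y).
    rewrite -(sum_drop stat s (n.+1 - s) (phi s)) subnKC//.
  by rewrite -(sum_take pS s (n.+1 - s) (phi s)) subnK.
rewrite [leRHS]mulrC ler_wpM2l ?invr_ge0 ?(ltW n0)// SE.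
have T0 : 0 < \sum_(z : n.+1.-tuple bool) W z by have := prefix_weight_gt0 n.+1 [::].
apply: (@le_trans _ _
  (\sum_(z : n.+1.-tuple bool) p z * ln (\sum_(z : n.+1.-tuple bool) W z))).
  apply: ler_sum => z _.
  have [pz|pz] := eqVneq (p z) 0; first by rewrite pz !mul0r.
  have {}pz : 0 < p z by rewrite lt0r pz p0.
  rewrite ler_wpM2l ?(ltW pz)//.
  have -> : \sum_(s < n.+1) phi s (take (n.+1 - s) z) = G n.+1 z - G 0 z.
    rewrite -(telescope_sumr (fun t => G t z)) // big_mkord.
    rewrite [RHS](reindex_inj rev_ord_inj) /=; apply: eq_bigr => s _.
    have sn : (s <= n)%N by rewrite -ltnS.
    rewrite /phi /G subSS subSn // take_takel ?leqnSn // .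
    have -> : (n.+1 - (n - s).+1 = s)%N by lia.
    have -> : (n.+1 - (n - s) = s.+1)%N by lia.
    by ring.
  rewrite /G subnn subn0 take0 take_oversize ?size_tuple//.
  have -> : log_law [::] = 0 by rewrite /log_law /= M0 ln1.
  have -> : prefix_weight 0 z = W z by rewrite /prefix_weight (sum_tuple0 (fun u => W (z ++ u))) cats0.
  have -> : prefix_weight n.+1 [::] = \sum_(z : n.+1.-tuple bool) W z by [].
  have : log_law z <= ln (W z).
    by rewrite ler_ln ?posrE ?W0 ?law_after_first_gt0 ?lawW.
  by lra.
by rewrite -mulr_suml sum_law // A0 mul1r.
Qed.

End RenewalRisk.
End Compression.

(** * The law of a renewal process *)

Section Cylinders.
Local Open Scope classical_set_scope.
Implicit Types (x : seq bool) (r : nat) (t : nat -> nat).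

Definition renewal_at t j : bool := `[< exists k, (\sum_(i < k.+1) t i)%N = j >].

(** The constraints that a string puts on the successive gaps, all exact
except the last one. *)
Fixpoint gap_sets r x : seq (set nat) :=
  match x with
  | [::] => [:: [set g | (r < g)%N]]
  | b :: y => if b then [set r.+1] :: gap_sets 0 y else gap_sets r.+1 y
  end.

Lemma renewal_at_first t r : (forall i, (0 < t i)%N) -> (r < t 0)%N ->
  renewal_at t r.+1 = (t 0 == r.+1).
Proof.
move=> t0 rt; apply/asboolP/eqP => [[[|k]]|<-]; first by rewrite big_ord_recl big_ord0 addn0.
  by rewrite -(big_mkord xpredT t) !big_nat_recl //=; have := t0 1%N; lia.
by exists 0%N; rewrite big_ord_recl big_ord0 addn0.
Qed.

Lemma renewal_at_shift t j : (0 < j)%N ->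
  renewal_at t (t 0 + j) = renewal_at (t \o succn) j.
Proof.
move=> j0; apply/asboolP/asboolP => [[[|k]]|[k kj]].
- rewrite big_ord_recl big_ord0 addn0 => e; move: j0.
  by rewrite -(ltn_add2l (t 0)) addn0 -e ltnn.
- by rewrite big_ord_recl => /addnI kj; exists k.
- by exists k.+1; rewrite big_ord_recl; congr (_ + _)%N.
Qed.

Lemma gap_sets_cons r x :
  gap_sets r x = head setT (gap_sets r x) :: behead (gap_sets r x).
Proof. by elim: x r => [|[] x IHx] r /=. Qed.

(** Gaps beyond those listed are unconstrained, which is what the default
value [setT] expresses; [r] is the time elapsed since the last renewal. *)
Lemma gap_setsP t r x : (forall i, (0 < t i)%N) ->
  ((r < t 0)%N /\ forall j, (j < size x)%N -> renewal_at t (r + j.+1) = nth false x j) <->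
  (forall i, nth setT (gap_sets r x) i (t i)).
Proof.
elim: x t r => [|b x IHx] t r t0 /=.
  split=> [[rt _] [|i]|/(_ 0%N)] //=; last by rewrite nth_nil.
have ts i : (0 < (t \o succn) i)%N by exact: t0.
case: b; split.
- move=> [rt H] [|i] /=.
    by have := H 0%N isT; rewrite addn1 renewal_at_first// => /eqP.
  have t0r : t 0 = r.+1 by have := H 0%N isT; rewrite addn1 renewal_at_first// => /eqP.
  move: i; apply/(IHx (t \o succn) 0%N ts); split=> [|j jx]; first exact: t0.
  have /= <- := H j.+1 jx; rewrite add0n -renewal_at_shift // t0r; congr renewal_at; lia.
- move=> H; have /= t0r := H 0%N; split; first by rewrite t0r.
  case=> [_|j jx]; first by rewrite addn1 renewal_at_first ?t0r ?eqxx.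
  have [_ H'] := (IHx (t \o succn) 0%N ts).2 (fun i => H i.+1).
  by rewrite /= -(H' j jx) add0n -renewal_at_shift // t0r; congr renewal_at; lia.
- move=> [rt H]; apply/(IHx t r.+1 t0); split.
    have := H 0%N isT; rewrite addn1 renewal_at_first// => /eqP/eqP t0r.
    by rewrite ltn_neqAle eq_sym t0r.
  by move=> j jx; have /= <- := H j.+1 jx; rewrite addSnnS.
- move=> /(IHx t r.+1 t0)[rt H]; split; first exact: ltnW.
  case=> [_|j jx]; last by rewrite /= -(H j jx) addSnnS.
  by rewrite addn1 renewal_at_first ?(ltnW rt)// gtn_eqF.
Qed.

End Cylinders.

Section RenewalLaw.
Local Open Scope classical_set_scope.
Context {R : realType} {d : measure_display} {Omega : measurableType d}.
Variable P : probability Omega R.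

Lemma blockP (X : nat -> Omega -> bool) s m (x : m.-tuple bool) w :
  block X s m w = x <-> forall i, (i < m)%N -> X (s + i.+1)%N w = nth false x i.
Proof.
split=> [<- i im|H].
  by rewrite (nth_map (Ordinal im)) ?nth_ord_enum ?size_enum_ord //= nth_enum_ord.
apply: eq_from_tnth => i; rewrite tnth_mktuple (tnth_nth false); exact: H.
Qed.

Variables (mu : probability nat R) (T : nat -> {RV P >-> nat}).
Hypothesis rT : renewal_times mu T.
Let X := renewal_process T.

Let Tpos k w : (0 < T k w)%N. Proof. by case: rT. Qed.

Definition delay_surv r : R := fine (P (T 0 @^-1` [set g | (r < g)%N])).
Definition gap_surv r : R := fine (mu [set g | (r < g)%N]).

Lemma block_cylinder m (x : m.-tuple bool) :
  [set w | block X 0 m w = x] =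
  \bigcap_(i in [set` iota 0 (size (gap_sets 0 x))])
     (T i @^-1` nth setT (gap_sets 0 x) i).
Proof.
apply/seteqP; split=> w /=.
  move/blockP => H i _ /=; move: i; apply/(gap_setsP 0 x (fun i => Tpos i w)).
  by split=> // j; rewrite size_tuple => jm; rewrite -H.
move=> H; apply/blockP => i im.
have /(gap_setsP 0 x (fun i => Tpos i w)) [_ H'] :
    forall i, nth setT (gap_sets 0 x) i (T i w).
  move=> j; have [js|js] := ltnP j (size (gap_sets 0 x)); last by rewrite nth_default.
  by apply: H; rewrite /= mem_iota.
by rewrite -H' ?size_tuple.
Qed.

(** Adding one earlier symbol; by induction it reduces all blocks to blocks
starting at time 1. *)
Lemma block_shift s m (x : m.-tuple bool) :
  [set w | block X s.+1 m w = x] =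
  [set w | block X s m.+1 w = [tuple of true :: x]] `|`
  [set w | block X s m.+1 w = [tuple of false :: x]].
Proof.
have H b w : X s.+1 w = b -> block X s.+1 m w = x -> block X s m.+1 w = [tuple of b :: x].
  move=> Xb /blockP H; apply/blockP => -[_|i im] /=; first by rewrite addn1.
  by rewrite -H // addSnnS.
apply/seteqP; split=> w /= => [xE|].
  by case E : (X s.+1 w); [left|right]; exact: H.
move=> xE; have {xE} [b /blockP xE] : exists b, block X s m.+1 w = [tuple of b :: x].
  by case: xE => xE; eexists; exact: xE.
by apply/blockP => i im; have /= <- := xE i.+1 im; rewrite addSnnS.
Qed.

Lemma measurable_block s m (x : m.-tuple bool) : measurable [set w | block X s m w = x].
Proof.
elim: s m x => [|s IHs] m x; last by rewrite block_shift; apply: measurableU.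
rewrite block_cylinder; apply: fin_bigcap_measurable; first exact: finite_seq.
by move=> i _; exact: measurable_funPTI.
Qed.

Lemma fine_diff_surv (Q : probability nat R) r :
  fine (Q [set r.+1]) = fine (Q [set g | (r < g)%N]) - fine (Q [set g | (r.+1 < g)%N]).
Proof.
have -> : [set g | (r < g)%N] = [set r.+1] `|` [set g | (r.+1 < g)%N].
  apply/seteqP; split=> g /=; last by case=> [->|/ltnW].
  by rewrite leq_eqVlt => /orP[/eqP<-|]; [left|right].
rewrite measureU//; last by apply/seteqP; split=> // g /= [->]; rewrite ltnn.
by rewrite fineD ?fin_num_measure// addrK.
Qed.

Lemma law_gap_sets (Q0 Q : probability nat R) r x :
  law (fun r => fine (Q0 [set g | (r < g)%N])) (fun r => fine (Q [set g | (r < g)%N])) r x =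
  fine (Q0 (head setT (gap_sets r x))) * \prod_(B <- behead (gap_sets r x)) fine (Q B).
Proof.
elim: x r Q0 => [|[] x IHx] r Q0 /=; first by rewrite big_nil mulr1.
  by rewrite -fine_diff_surv IHx [in RHS]gap_sets_cons big_cons.
exact: IHx.
Qed.

Lemma block_law0 m (x : m.-tuple bool) :
  block_law P X 0 x = law delay_surv gap_surv 0 x.
Proof.
rewrite /block_law block_cylinder.
case: rT => indep _ dist _.
rewrite indep ?iota_uniq//.
rewrite (law_gap_sets (distribution P (T 0)) mu 0 x).
rewrite gap_sets_cons; move: (head _ _) (behead _) => B s /=.
rewrite (eq_bigr (fun i => (fine (P (T i @^-1` nth setT (B :: s) i)))%:E));
  last first => [i _|].
  by rewrite fineK // fin_num_measure //; exact: measurable_funPTI.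
rewrite -(big_morph EFin EFinM erefl) big_cons /=; congr (_ * _).
rewrite -(addn0 1%N) iotaDl big_map (big_nth setT) /index_iota subn0.
by apply: eq_bigr => i _; rewrite add1n /= -(dist i).
Qed.

Lemma block_law_sum s m (x : m.-tuple bool) :
  block_law P X s x = \sum_(y : s.-tuple bool) law delay_surv gap_surv 0 (y ++ x).
Proof.
elim: s m x => [|s IHs] m x.
  by rewrite (sum_tuple0 (fun y => law delay_surv gap_surv 0 (y ++ x))) block_law0.
rewrite (sum_tuple_rcons s (fun y => law delay_surv gap_surv 0 (y ++ x))) exchange_big.
have -> : block_law P X s.+1 x = \sum_(b : bool) block_law P X s [tuple of b :: x].
  rewrite big_bool /block_law block_shift measureU ?fineD ?fin_num_measure//;
    try exact: measurable_block.
  by apply/seteqP; split=> // w [/= -> /(congr1 (fun t => thead t))].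
by apply: eq_bigr => b _; rewrite IHs; apply: eq_bigr => y _; rewrite cat_rcons.
Qed.

Lemma stationary_law :
  stationary P X <-> forall x,
    \sum_(b : bool) law delay_surv gap_surv 0 (b :: x) = law delay_surv gap_surv 0 x.
Proof.
split=> [st x|H s m x].
  have := st 1%N _ (in_tuple x); rewrite block_law_sum block_law0 => <-.
  rewrite (sum_tuple_cons 0 (fun y => law delay_surv gap_surv 0 (y ++ x))).
  by rewrite (sum_tuple0 (fun y => \sum_b law delay_surv gap_surv 0 ((b :: y) ++ x))).
rewrite block_law_sum block_law0.
elim: s => [|s IHs].
  by rewrite (sum_tuple0 (fun y => law delay_surv gap_surv 0 (y ++ x))).
rewrite (sum_tuple_cons s (fun y => law delay_surv gap_surv 0 (y ++ x))) -IHs.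
by apply: eq_bigr => y _ /=; exact: H.
Qed.

Lemma probability_survival (Q : probability nat R) :
  survival (fun r => fine (Q [set g | (r < g)%N])).
Proof.
split=> r; first exact: fine_ge0.
by rewrite -subr_ge0 -fine_diff_surv fine_ge0.
Qed.

Lemma delay_surv_survival : survival delay_surv.
Proof. exact: (probability_survival (distribution P (T 0))). Qed.

Lemma gap_surv_survival : survival gap_surv.
Proof. exact: probability_survival. Qed.

Lemma delay_surv0 : delay_surv 0 = 1.
Proof.
rewrite /delay_surv (_ : _ @^-1` _ = setT) ?probability_setT//.
by apply/seteqP; split=> // w _; exact: Tpos.
Qed.

Lemma gap_surv0 : gap_surv 0 = 1.
Proof.
case: rT => _ _ dist _; rewrite /gap_surv -(dist 0%N) /distribution /pushforward.
rewrite (_ : _ @^-1` _ = setT) ?probability_setT//.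
by apply/seteqP; split=> // w _; exact: Tpos.
Qed.

End RenewalLaw.

(** * Existence of stationary renewal processes *)

Section Coding.
Local Open Scope classical_set_scope.
Variables (R : realType) (K : nat) (S : nat -> R).
Hypotheses (S0 : S 0 = 1) (sS : survival S) (SK : S K = 0).

(** The unit interval is divided into the intervals [[S g.+1, S g[], of length
the mass of the gap [g + 1]; the code of [u] is the gap whose interval
contains [u]. *)
Definition code (u : R) : nat := (find (fun j => S j.+1 <= u) (iota 0 K)).+1.

(** Position of [u] inside its interval, again uniform on the unit
interval. *)
Definition rescale (u : R) : R :=
  (u - S (code u)) / (S (code u).-1 - S (code u)).

Lemma surv_anti i j : (i <= j)%N -> S j <= S i.
Proof.
move=> /subnKC <-; elim: (j - i)%N => [|k IHk]; first by rewrite addn0.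
by rewrite addnS (le_trans (sS.2 _)).
Qed.

Lemma code_le u : (code u <= K.+1)%N.
Proof. by rewrite ltnS -[leqRHS](size_iota 0 K) find_size. Qed.

Let below u := fun j => S j.+1 <= u.

Lemma has_code u : 0 <= u -> has (below u) (iota 0 K).
Proof.
move=> u0; have K0 : (0 < K)%N.
  rewrite lt0n; apply: contraTneq isT => K0.
  by move: SK; rewrite K0 S0 => /eqP; rewrite oner_eq0.
by apply/hasP; exists K.-1; rewrite ?mem_iota ?add0n ?ltn_predL// /below prednK// SK.
Qed.

Lemma code_leK u : 0 <= u -> (code u <= K)%N.
Proof. by move=> u0; have := has_code u0; rewrite has_find size_iota. Qed.

Lemma codeP u g : 0 <= u < 1 -> (code u == g.+1) = (S g.+1 <= u < S g).
Proof.
move=> /andP[u0 u1]; have ha := has_code u0; have fK := code_leK u0.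
rewrite /code -/(below u) in fK *.
have f1 : S (find (below u) (iota 0 K)).+1 <= u by have := nth_find 0%N ha; rewrite nth_iota.
have f2 : u < S (find (below u) (iota 0 K)).
  case E : (find (below u) (iota 0 K)) => [|f]; first by rewrite S0.
  have := @before_find _ 0%N (below u) (iota 0 K) f; rewrite E ltnS leqnn => /(_ isT).
  rewrite nth_iota ?add0n; last by apply: ltn_trans fK; rewrite E.
  by rewrite /below => /negbT; rewrite -ltNge.
rewrite eqSS; apply/eqP/idP => [<-|/andP[g1 g2]]; first by rewrite f1 f2.
have [fg|gf|//] := ltngtP (find (below u) (iota 0 K)) g.
- by have := lt_le_trans g2 (surv_anti fg); rewrite ltNge f1.
- by have := lt_le_trans f2 (surv_anti gf); rewrite ltNge g1.
Qed.

Lemma code_bounds u : 0 <= u < 1 -> S (code u) <= u < S (code u).-1.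
Proof. by move=> u01; rewrite -codeP. Qed.

Lemma rescale_bounds u : 0 <= u < 1 -> 0 <= rescale u < 1.
Proof.
move=> u01; have /andP[h1 h2] := code_bounds u01; rewrite /rescale.
have d0 : 0 < S (code u).-1 - S (code u) by lra.
by apply/andP; split; [apply: divr_ge0; lra|rewrite ltr_pdivrMr//; lra].
Qed.

(** Inside the interval of a given gap, rescaling is affine. *)
Lemma code_rescale u g a b : 0 <= u < 1 -> 0 <= a -> b <= 1 ->
  ((code u == g.+1) && (a <= rescale u < b)) =
  (S g.+1 + (S g - S g.+1) * a <= u < S g.+1 + (S g - S g.+1) * b).
Proof.
move=> u01 a0 b1; have := sS.2 g; rewrite -subr_ge0 => w0.
apply/andP/idP => [[cu]|/andP[h1 h2]].
  have := cu; rewrite codeP// => /andP[h1 h2].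
  rewrite /rescale (eqP cu) /=; have d0 : 0 < S g - S g.+1 by lra.
  by rewrite ler_pdivlMr// ltr_pdivrMr// => /andP[h3 h4]; apply/andP; split; lra.
have cu : code u == g.+1.
  by rewrite codeP//; apply/andP; split; nra.
split=> //; rewrite /rescale (eqP cu) /=.
have d0 : 0 < S g - S g.+1 by move: cu; rewrite codeP// => /andP[h3 h4]; lra.
by rewrite ler_pdivlMr// ltr_pdivrMr//; apply/andP; split; lra.
Qed.

Lemma measurable_code : measurable_fun setT code.
Proof.
apply: measurableT_comp => //.
elim: (iota 0 K) => [|j s IHs] /=; first exact: measurable_cst.
apply: measurable_fun_ifT => //; first exact: measurable_fun_ler.
by apply: measurableT_comp.
Qed.

Lemma measurable_rescale : measurable_fun setT rescale.
Proof.
have mc (f : nat -> R) : measurable_fun setT (f \o code).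
  by apply: measurableT_comp; [|exact: measurable_code].
apply: measurable_funM.
  by apply: measurable_funB => //; exact: (mc S).
exact: (mc (fun g => (S g.-1 - S g)^-1)).
Qed.

Definition gap_mass (B : set nat) : R :=
  \sum_(g < K | `[< B g.+1 >]) (S g - S g.+1).

Lemma sum_surv_steps m : (m <= K)%N -> \sum_(m <= g < K) (S g - S g.+1) = S m.
Proof.
move=> mK; rewrite (@telescope_sumr_eq _ m K (fun g => - S g)) //.
  by rewrite SK oppr0 sub0r opprK.
by move=> g _; rewrite opprK addrC.
Qed.

Lemma gap_massT : gap_mass setT = 1.
Proof.
rewrite /gap_mass (eq_bigl xpredT) => [|g]; last by apply/asboolP.
by rewrite -(big_mkord xpredT (fun g => S g - S g.+1)) sum_surv_steps.
Qed.

Lemma gap_mass_tail r : gap_mass [set g | (r < g)%N] = S r.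
Proof.
rewrite /gap_mass (eq_bigl (fun g : 'I_K => (r <= g)%N)); last first.
  by move=> g; apply/asboolP/idP; rewrite /= ltnS.
have [rK|Kr] := leqP r K; last first.
  rewrite big_pred0; last by move=> g; have := ltn_ord g; lia.
  by apply/esym/le_anti; rewrite sS.1 -SK surv_anti// ltnW.
by rewrite -(sum_surv_steps rK) (@big_nat_widenl _ _ _ r 0%N) // big_mkord.
Qed.

End Coding.

Section IndependentSequence.
Local Open Scope classical_set_scope.
Variables (R : realType) (K : nat) (S : nat -> nat -> R).
Hypotheses (S0 : forall k, S k 0 = 1) (sS : forall k, survival (S k)).
Hypothesis SK : forall k, S k K = 0.

Let P : probability (measurableTypeR R) R := uniform_prob (@ltr01 R).

(** Expansion of a point of the unit interval in mixed bases, the [k]-th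
digit having survival function [S k]. *)
Fixpoint digits k (w : R) : R :=
  if k is k'.+1 then rescale K (S k') (digits k' w) else w.

Definition coded_time k w := code K (S k) (digits k w).

Lemma measurable_digits k : measurable_fun setT (digits k).
Proof.
elim: k => [|k IHk]; first exact: measurable_id.
by apply: (@measurableT_comp _ _ _ _ _ _ (rescale K (S k))); first exact: measurable_rescale.
Qed.

Lemma measurable_coded_time k : measurable_fun setT (coded_time k).
Proof.
apply: (@measurableT_comp _ _ _ _ _ _ (code K (S k))); first exact: measurable_code.
exact: measurable_digits.
Qed.

Lemma digits_bounds k w : 0 <= w < 1 -> 0 <= digits k w < 1.
Proof. by elim: k => //= k IHk w01; apply: rescale_bounds => //; exact: IHk. Qed.

Lemma uniform_itv a b : 0 <= a -> a <= b -> b <= 1 ->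
  P [set w | a <= w < b] = (b - a)%:E.
Proof.
move=> a0 ab b1; have -> : [set w | a <= w < b] = `[a, b[%classic.
  by apply/seteqP; split=> w; rewrite /= in_itv.
have abE : `[a, b[%classic `&` `[0, 1]%classic = `[a, b[%classic :> set R.
  apply/setIidPl => w; rewrite /= !in_itv /= => /andP[aw wb].
  by apply/andP; split; lra.
rewrite -[LHS]/(uniform_prob (@ltr01 R) `[a, b[%classic) /uniform_prob.
rewrite integral_uniform_pdf abE.
rewrite (eq_integral (cst 1%:E)) => [|w]; last first.
  rewrite inE /= in_itv /= => /andP[aw wb]; rewrite /uniform_pdf subr0 invr1.
  by rewrite (_ : 0 <= w <= 1)//; apply/andP; split; lra.
rewrite integral_cst //= mul1e lebesgue_measure_itv /= lte_fin.
by case: ltP => [//|ba]; rewrite (_ : b - a = 0)//; lra.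
Qed.

Let cylinder k (B : nat -> set nat) a b :=
  [set w | 0 <= w < 1 /\ (forall i, (i < k)%N -> B i (coded_time i w)) /\
           a <= digits k w < b].

Lemma measurable_cylinder k B a b : measurable (cylinder k B a b).
Proof.
have -> : cylinder k B a b = [set w | 0 <= w < 1] `&`
   (\bigcap_(i in `I_k) coded_time i @^-1` B i) `&` (digits k @^-1` `[a, b[%classic).
  apply/seteqP; split=> w /=; rewrite in_itv /=.
    by move=> [? [? ?]].
  by move=> [[? ?] ?].
apply: measurableI; last first.
  by rewrite -[X in measurable X]setTI; apply: measurable_digits => //; exact: measurable_itv.
apply: measurableI; last first.
  apply: fin_bigcap_measurable; first exact: finite_II.
  by move=> i _; rewrite -[X in measurable X]setTI; apply: measurable_coded_time.
rewrite (_ : [set w | 0 <= w < 1] = `[0, 1[%classic); first exact: measurable_itv.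
by apply/seteqP; split=> w; rewrite /= in_itv.
Qed.

(** A cylinder of rank [k + 1] is a disjoint union, over the admissible values
of the last gap, of cylinders of rank [k] with a smaller remainder interval. *)
Lemma cylinder_prob k B a b : 0 <= a -> a <= b -> b <= 1 ->
  P (cylinder k B a b) = ((\prod_(i < k) gap_mass K (S i) (B i)) * (b - a))%:E.
Proof.
elim: k a b => [|k IHk] a b a0 ab b1.
  rewrite big_ord0 mul1r -uniform_itv//; congr (P _).
  apply/seteqP; split=> w /=; first by case=> _ [].
  by move=> /andP[aw wb]; split; [apply/andP; split; lra|split=> //; apply/andP].
(* The interval of remainders of rank [k] that lead to the gap [g + 1] and to a
   next remainder in [[a, b[]. *)
pose lo g := S k g.+1 + (S k g - S k g.+1) * a.
pose hi g := S k g.+1 + (S k g - S k g.+1) * b.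
have -> : cylinder k.+1 B a b =
  \big[setU/set0]_(g < K) ([set w | B k g.+1] `&` cylinder k B (lo g) (hi g)).
  rewrite -(bigcup_mkord K (fun g => [set w | B k g.+1] `&` cylinder k B (lo g) (hi g))).
  apply/seteqP; split=> w.
    move=> [w01 [Bw /= dw]].
    have u01 := digits_bounds k w01; have /andP[u0 _] := u01.
    have Bk := Bw k (ltnSn k).
    exists (code K (S k) (digits k w)).-1 => /=; first exact: code_leK.
    split=> //; split=> //; split; first by move=> i ik; apply: Bw; exact: ltnW.
    by rewrite -(code_rescale (S0 k) (sS k) (SK k)) // eqxx.
  move=> [g gK [Bg [w01 [Bw dw]]]].
  have u01 := digits_bounds k w01.
  move: dw; rewrite -(code_rescale (S0 k) (sS k) (SK k)) // => /andP[/eqP cg dw].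
  split=> //; split=> // i; rewrite ltnS leq_eqVlt => /orP[/eqP->|/Bw//].
  by rewrite /coded_time cg.
have mF g : measurable ([set w | B k g.+1] `&` cylinder k B (lo g) (hi g)).
  have [Bg|nBg] := pselect (B k g.+1).
    rewrite (_ : [set w | B k g.+1] = setT) ?setTI; first exact: measurable_cylinder.
    by apply/seteqP; split.
  rewrite (_ : [set w | B k g.+1] = set0) ?set0I; first exact: measurable0.
  by apply/seteqP; split.
rewrite (measure_semi_additive_ord_I P
  (F := fun g => [set w | B k g.+1] `&` cylinder k B (lo g) (hi g))) //; last 2 first.
- move=> i j /= iK jK [w [[_ [w01 [_ d1]]] [_ [_ [_ d2]]]]].
  have u01 := digits_bounds k w01.
  move: d1 d2; rewrite -!(code_rescale (S0 k) (sS k) (SK k)) //.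
  move=> /andP[/eqP ci _] /andP[/eqP cj _].
  by move: ci; rewrite cj => -[].
- by apply: bigsetU_measurable => g _; exact: mF.
rewrite big_ord_recr /= -mulrA [gap_mass _ _ _ * _]mulrC /gap_mass !mulr_sumr -sumEFin.
rewrite [RHS]big_mkcond; apply: eq_bigr => g _; have w0 := sS k.
have [Bg|nBg] := asboolP (B k g.+1); last first.
  by rewrite (_ : [set w | B k g.+1] = set0) ?set0I ?measure0//; apply/seteqP; split.
rewrite (_ : [set w | B k g.+1] = setT) ?setTI; last by apply/seteqP; split.
have d0 : 0 <= S k g - S k g.+1 by rewrite subr_ge0 (sS k).2.
have g1 : S k g <= 1 by rewrite -(S0 k); exact: (surv_anti (sS k)).
have g0 := (sS k).1 g.+1.
rewrite IHk /lo /hi; last 3 first.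
+ by rewrite addr_ge0 // mulr_ge0.
+ by rewrite lerD2l ler_wpM2l.
+ by nra.
  by congr EFin; ring.
by move=> g _; exact: mF.
Qed.

(** The points outside of the unit interval, for which the expansion is
meaningless, have probability zero. *)
Lemma coded_times_prob N (B : nat -> set nat) :
  P [set w | forall i, (i < N)%N -> B i (coded_time i w)] =
  (\prod_(i < N) gap_mass K (S i) (B i))%:E.
Proof.
have mE : measurable [set w | forall i, (i < N)%N -> B i (coded_time i w)].
  rewrite (_ : [set w | _] = \bigcap_(i in `I_N) coded_time i @^-1` B i).
    apply: fin_bigcap_measurable; first exact: finite_II.
    by move=> i _; rewrite -[X in measurable X]setTI; apply: measurable_coded_time.
  by apply/seteqP; split.
have := cylinder_prob N B (lexx 0) ler01 (lexx 1); rewrite subr0 mulr1 => <-.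
have mev := measurable_cylinder N B 0 1.
apply/eqP; rewrite eq_le; apply/andP; split; last first.
  by apply: le_measure; rewrite ?inE // => w [_ []].
have PD : P [set w | 0 <= w < 1] = 1%E by rewrite uniform_itv// subr0.
have mD : measurable [set w : R | 0 <= w < 1].
  rewrite (_ : [set w | 0 <= w < 1] = `[0, 1[%classic); first exact: measurable_itv.
  by apply/seteqP; split=> w; rewrite /= in_itv.
have PDC : P (~` [set w | 0 <= w < 1]) = 0%E by rewrite probability_setC// PD subee.
apply: (@le_trans _ _ (P (cylinder N B 0 1 `|` ~` [set w | 0 <= w < 1]))).
  apply: le_measure; rewrite ?inE //; first by apply: measurableU => //; exact: measurableC.
  move=> w Bw; have [w01|w01] := pselect (0 <= w < 1); last by right.
  by left; split=> //; split=> //; exact: digits_bounds.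
apply: le_trans (measureU2 _ _ _) _ => //; first exact: measurableC.
by rewrite [X in (_ + X)%E]PDC adde0.
Qed.

Definition coded_rv k : {RV P >-> nat} :=
  HB.pack_for {mfun measurableTypeR R >-> nat} (coded_time k)
    (isMeasurableFun.Build _ _ (measurableTypeR R) nat (coded_time k)
       (@measurable_coded_time k)).

Lemma coded_rv_prob k B : P (coded_rv k @^-1` B) = (gap_mass K (S k) B)%:E.
Proof.
have -> : coded_rv k @^-1` B = [set w | forall i, (i < k.+1)%N ->
    (if i == k then B else setT) (coded_time i w)].
  apply/seteqP; split=> w /=; last by move=> /(_ k (ltnSn k)); rewrite eqxx.
  by move=> Bw i _; case: eqP => // ->.
rewrite (coded_times_prob k.+1 (fun i => if i == k then B else setT)).
rewrite big_ord_recr /= eqxx big1 ?mul1r// => i _.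
by rewrite (ltn_eqF (ltn_ord i)) gap_massT.
Qed.

(** A finite subfamily is completed by trivial constraints to an initial
segment. *)
Lemma coded_rv_independent : mutually_independent coded_rv.
Proof.
move=> s B us _; pose N := (\max_(i <- s) i)%N.+1.
have sN i : i \in s -> (i < N)%N.
  by move=> si; rewrite ltnS; exact: (@leq_bigmax_seq _ s xpredT (fun i : nat => i) i si).
have -> : \bigcap_(i in [set` s]) (coded_rv i @^-1` B i) =
  [set w | forall i, (i < N)%N -> (if i \in s then B i else setT) (coded_time i w)].
  apply/seteqP; split=> w /=.
    by move=> Bw i _; case: ifPn => // si; exact: Bw.
  by move=> Bw i /= si; have := Bw i (sN i si); rewrite si.
rewrite (coded_times_prob N (fun i => if i \in s then B i else setT)).
under [RHS]eq_bigr do rewrite coded_rv_prob.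
rewrite -(big_morph EFin EFinM erefl) /=; congr EFin.
rewrite (eq_bigr (fun i : 'I_N =>
  if (i : nat) \in s then gap_mass K (S i) (B i) else 1)); last first.
  by move=> i _; case: ifP => // _; rewrite gap_massT.
rewrite -(big_mkord xpredT (fun i => if i \in s then gap_mass K (S i) (B i) else 1)).
rewrite -big_mkcond.
rewrite -big_filter; apply: perm_big; apply: uniq_perm => //.
  by rewrite filter_uniq// iota_uniq.
by move=> i; rewrite mem_filter mem_index_iota leq0n /=; apply: andb_idr; exact: sN.
Qed.

End IndependentSequence.

Section Membership.
Local Open Scope classical_set_scope.
Variables (R : realType) (K : nat) (M : nat -> R).
Hypotheses (M0 : M 0 = 1) (sM : survival M) (MK : forall r, (K <= r)%N -> M r = 0).

(** The delay takes its digit from the equilibrium distribution and all later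
digits come from [M]. *)
Lemma equilibrium_renewal_law n :
  @renewal_laws R n (fun x : n.+1.-tuple bool => law (equilibrium K M) M 0 x).
Proof.
pose S k := if k is 0%N then equilibrium K M else M.
have S0 k : S k 0 = 1 by case: k => // ; exact: equilibrium0 M0 sM MK.
have sS k : survival (S k) by case: k => // ; exact: equilibrium_survival M0 sM MK.
have SK k : S k K = 0 by case: k => [|k] /=; [exact: equilibrium_above|exact: MK].
pose P : probability (measurableTypeR R) R := uniform_prob (@ltr01 R).
pose T := coded_rv K S : nat -> {RV P >-> nat}.
pose mu : probability nat R := distribution P (T 1%N).
have TB k B : P (T k @^-1` B) = (gap_mass K (S k) B)%:E by exact: coded_rv_prob.
have rT : renewal_times mu T.
  split.
  - exact: coded_rv_independent.
  - by [].
  - move=> k A; rewrite -[LHS]/(P (T k.+1 @^-1` A)) -[RHS]/(P (T 1%N @^-1` A)).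
    by rewrite (TB k.+1) (TB 1%N).
  rewrite ge0_integral_distribution //.
  apply: (@le_lt_trans _ _ (\int[P]_x (K.+1%:R)%:E)%E).
    apply: ge0_le_integral => //.
    - by move=> w _; rewrite lee_fin.
    - apply: (@measurableT_comp _ _ _ _ _ _ (fun y : nat => (y%:R)%:E)) => //.
    - by move=> w _; rewrite lee_fin ler_nat; exact: code_le.
  by rewrite integral_cst // [X in (_ * X)%E]probability_setT mule1 ltry.
have dE : delay_surv T = equilibrium K M.
  apply/funext => r; rewrite /delay_surv TB /=.
  by rewrite (gap_mass_tail (sS 0%N) (SK 0%N)).
have gE : gap_surv mu = M.
  apply/funext => r; rewrite /gap_surv.
  rewrite -[X in fine X]/(P (T 1%N @^-1` [set g | (r < g)%N])) TB /=.
  by rewrite (gap_mass_tail (sS 1%N) (SK 1%N)).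
exists _, (measurableTypeR R), P, mu, T; split => //.
  apply/(stationary_law rT) => x; rewrite dE gE.
  by apply: law_stationary => //; exact: equilibrium_step.
by apply/funext => x; rewrite (block_law0 rT) dE gE.
Qed.

End Membership.

(** * The rate of the prediction risk *)

Section HellingerLowerBound.
Variable R : realType.

(** [ln x <= x - 1] at [x = sqrt (q / p)]. *)
Lemma kl_term_ge (p q : R) : 0 < p -> 0 < q ->
  2 * p - 2 * (Num.sqrt p * Num.sqrt q) <= p * ln (p / q).
Proof.
move=> p0 q0; set a := Num.sqrt p; set b := Num.sqrt q.
have a0 : 0 < a by rewrite sqrtr_gt0.
have b0 : 0 < b by rewrite sqrtr_gt0.
have -> : p = a ^+ 2 by rewrite sqr_sqrtr // ltW.
have -> : q = b ^+ 2 by rewrite sqr_sqrtr // ltW.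
have ba : 0 < b / a by rewrite divr_gt0.
have := ln_le_tangent ba ltr01; rewrite ln1 add0r divr1 => h.
have -> : ln (a ^+ 2 / b ^+ 2) = - (2 * ln (b / a)).
  have -> : a ^+ 2 / b ^+ 2 = ((b / a) ^+ 2)^-1 by field; rewrite !gt_eqF.
  by rewrite lnV ?posrE ?exprn_gt0 // lnXn // mulr_natl.
have := ler_wpM2l (ltW (exprn_gt0 2 a0)) h.
have -> : a ^+ 2 * (b / a - 1) = a * b - a ^+ 2 by field; rewrite gt_eqF.
by lra.
Qed.

(** The terms of [kl_term_ge] add up to the squared Hellinger distance because
both distributions have mass 1. *)
Lemma kl_div_ge_hellinger (p q : bool -> R) : is_pmf p -> is_pmf q ->
  (((Num.sqrt (p true) - Num.sqrt (q true)) ^+ 2)%:E <= kl_div p q)%E.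
Proof.
move=> [p0 p1] [q0 q1].
apply: (@le_trans _ _
  (\sum_(b : bool) (2 * p b - 2 * (Num.sqrt (p b) * Num.sqrt (q b)))%:E)%E).
  rewrite sumEFin lee_fin big_bool.
  move: p1 q1; rewrite !big_bool.
  have := sqr_sqrtr (p0 true); have := sqr_sqrtr (p0 false).
  have := sqr_sqrtr (q0 true); have := sqr_sqrtr (q0 false).
  have := sqr_ge0 (Num.sqrt (p false) - Num.sqrt (q false)).
  by rewrite /=; lra.
apply: lee_sum => b _.
have [pb|pb] := eqVneq (p b) 0; first by rewrite pb sqrtr0 mul0r mulr0 subrr.
have [qb|qb] := eqVneq (q b) 0; first by rewrite leey.
by rewrite lee_fin kl_term_ge // lt0r ?pb ?qb ?p0 ?q0.
Qed.

Lemma prediction_risk_ge_hellinger n (p : seq bool -> R) (Q : n.-tuple bool -> bool -> R)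
    (q : seq bool -> R) :
  (forall x, 0 <= p x) -> (forall x, \sum_(b : bool) p (rcons x b) = p x) ->
  (forall x, is_pmf (Q x)) -> (forall x : n.-tuple bool, q x = Q x true) ->
  ((hellinger_risk p q n)%:E <= prediction_risk (fun z : n.+1.-tuple bool => p z) Q)%E.
Proof.
move=> p0 pS Qp qQ; rewrite /hellinger_risk -sumEFin; apply: lee_sum => x _.
rewrite (past_marginalE pS).
have [px|px] := eqVneq (p x) 0; first by rewrite px !mul0r mul0e.
have {}px : 0 < p x by rewrite lt0r px p0.
rewrite EFinM lee_pmul2l // qQ -(next_given_pastE pS).
apply: kl_div_ge_hellinger => //; split=> [b|].
  by rewrite (next_given_pastE pS) divr_ge0.
under eq_bigr do rewrite (next_given_pastE pS).
by rewrite -mulr_suml pS divff // gt_eqF.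
Qed.

End HellingerLowerBound.

Section Bounds.
Variables (R : realType) (n k : nat).
Hypotheses (k0 : (0 < k)%N) (kn : (k ^ 2 <= n)%N) (nk : (n < k.+1 ^ 2)%N).

(** With [k] the integer part of [sqrt n], take [m = k - 1], [L = 8 k] and the
pairs [i] with [2 i < k], whose ages [m + 2 i] are all less than [n]. *)
Lemma risk_rnwl_ge : (((23 ^+ 3 * k%:R)^-1)%:E <= @risk_rnwl R n)%E.
Proof.
pose L := (8 * k)%N; pose m := k.-1; pose I := uphalf k; pose K := (m + L.*2)%N.
have L0 : (0 < L)%N by rewrite /L; lia.
have IL : (I <= L)%N by rewrite /I /L; lia.
have ages i : (i < I)%N -> (m + i.*2 < n)%N by move=> iI; rewrite /I /m in iI *; nia.
have rare : (2 * (n + m) <= m.+1 * L)%N by rewrite /m /L; nia.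
apply: le_ereal_inf_tmp => _ [Q Qp <-].
pose q s := if insub s is Some t then Q t true else 0.
have qQ (x : n.-tuple bool) : q x = Q x true by rewrite /q valK.
have [f hf] := exists_hard_signs L0 IL ages rare q.
have surv0 : signed_surv R m f 0 = 1 by exact: signed_surv0.
have ssurv : survival (signed_surv R m f) by exact: signed_tail_survival.
have survK r : (K <= r)%N -> signed_surv R m f r = 0 by exact: signed_surv_above.
have sE := equilibrium_survival surv0 ssurv survK.
apply: (@le_trans _ _
  (prediction_risk (fun z : n.+1.-tuple bool => signed_law R m f z) Q)); last first.
  apply: ereal_sup_ubound; exists (fun z : n.+1.-tuple bool => signed_law R m f z) => //.
  exact: equilibrium_renewal_law surv0 ssurv survK n.
apply: le_trans (prediction_risk_ge_hellinger _ _ Qp qQ); last 2 first.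
- by move=> x; exact: law_ge0.
- by move=> x; exact: law_rcons.
rewrite lee_fin; apply: le_trans hf.
have kR : 0 < k%:R :> R by rewrite ltr0n.
have KL : 0 < (40 * (m + L.*2) * L)%:R :> R by rewrite ltr0n /L /m; nia.
have hI : (k <= 2 * I)%N by rewrite /I; lia.
have hK : (40 * (m + L.*2) * L <= 40 * (17 * k) * L)%N.
  by rewrite leq_mul2r leq_mul2l /m /L; apply/orP; right; lia.
have h : (40 * (m + L.*2) * L <= I * (23 ^ 3 * k))%N.
  by apply: leq_trans hK _; rewrite /L; nia.
rewrite -[leLHS]mul1r ler_pdivlMr//; rewrite -natrX -natrM mulrAC mul1r.
rewrite ler_pdivrMr; first by rewrite -natrM ler_nat.
by rewrite natrM natrX mulr_gt0 // exprn_gt0.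
Qed.

(** The estimator built on the weights of string types of length [n + 1],
which is at most [(k + 1) ^ 2]. *)
Lemma risk_rnwl_le : (@risk_rnwl R n <= (30 * k%:R / n%:R)%:E)%E.
Proof.
pose W := @type_weight n.+1 R.
have W0 z : 0 < W z by exact: type_weight_gt0.
have n0 : 0 < n%:R :> R by rewrite ltr0n; nia.
have kR : 0 < k%:R :> R by rewrite ltr0n.
have lnW : ln (\sum_(z : n.+1.-tuple bool) W z) <= 30 * k%:R.
  have S0 : 0 < \sum_(z : n.+1.-tuple bool) W z.
    rewrite (bigD1 [tuple of nseq n.+1 false])//= ltr_pwDl// sumr_ge0 // => u _.
    exact: ltW.
  have N0 : (0 < n.+2 ^ 2)%N by [].
  have M0 : 0 < #|multiplicities n.+1|%:R :> R.
    by have := lt_le_trans S0 (sum_type_weight_le n.+1 R); rewrite !ltr0n muln_gt0 => /andP[].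
  apply: (@le_trans _ _ (ln ((n.+2 ^ 2 * #|multiplicities n.+1|)%:R))).
    by rewrite ler_ln ?posrE ?sum_type_weight_le // natrM mulr_gt0 // ltr0n.
  rewrite natrM lnM ?posrE ?M0 ?ltr0n//.
  have h1 : ln #|multiplicities n.+1|%:R <= 7 * k.+1%:R :> R.
    rewrite -[leRHS]expRK ler_ln ?posrE ?expR_gt0//.
    exact: card_multiplicities_le.
  have h2 : ln (n.+2 ^ 2)%:R <= 8 * k.+1%:R :> R.
    apply: (@le_trans _ _ (ln ((2 * k.+1)%:R ^+ 4))).
      rewrite ler_ln ?posrE ?exprn_gt0 ?ltr0n// -natrX ler_nat.
      rewrite (_ : (2 * k.+1) ^ 4 = ((2 * k.+1) ^ 2) ^ 2)%N ?leq_sqr -?expnM//; nia.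
    rewrite lnXn ?ltr0n// -[leLHS]mulr_natl.
    have := ln_sublinear (ltr0n R (2 * k.+1)); rewrite natrM => /ltW; lra.
  have : k.+1%:R <= 2 * k%:R :> R by rewrite -natrM ler_nat; lia.
  by lra.
apply: (@le_trans _ _ (ereal_sup
  [set prediction_risk p (@averaged_predictor R n W) | p in @renewal_laws R n]%classic)).
  apply: ereal_inf_lbound; exists (@averaged_predictor R n W) => //.
  by move=> x; exact: averaged_predictor_pmf.
apply: ge_ereal_sup => _ [p [d [U [P [mu [T [rT st pE]]]]]] <-].
rewrite {}pE {p}.
have -> : @block_law R d U P (renewal_process T) 0 n.+1 =
    (fun z : n.+1.-tuple bool => law (delay_surv T) (gap_surv mu) 0 z).
  by apply/funext => z; rewrite (block_law0 rT).
have stat := (stationary_law rT).1 st.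
apply: le_trans (prediction_risk_le W0 (delay_surv_survival T) (gap_surv_survival mu)
  (delay_surv0 rT) (gap_surv0 rT) stat _) _.
  by move=> z; apply: law_le_type_weight; [exact: gap_surv_survival|exact: gap_surv0 rT].
rewrite lee_fin.
apply: (@le_trans _ _ (30 * k%:R / n.+1%:R)); first by rewrite ler_wpM2r ?invr_ge0.
by rewrite ler_wpM2l ?mulr_ge0 // lef_pV2 ?posrE ?ltr0n ?ler_nat // -(ltr0n R).
Qed.

End Bounds.

Lemma exists_floor_sqrt n : (0 < n)%N ->
  exists k, [/\ (0 < k)%N, (k ^ 2 <= n)%N & (n < k.+1 ^ 2)%N].
Proof.
elim: n => // n IHn _; case: (posnP n) => [->|/IHn[k [k0 kn nk]]]; first by exists 1%N.
have [nk'|kn'] := ltnP n.+1 (k.+1 ^ 2); first by exists k; split=> //; exact: leqW.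
by exists k.+1; split=> //; nia.
Qed.

Theorem theorem4 (R : realType) :
  exists C : R, 0 < C /\
    forall n : nat, (0 < n)%N ->
      ((C^-1 * Num.sqrt (n%:R^-1))%:E <= @risk_rnwl R n)%E /\
      (@risk_rnwl R n <= (C * Num.sqrt (n%:R^-1))%:E)%E.
Proof.
exists (23 ^+ 3); split; first by rewrite exprn_gt0.
move=> n n0; have [k [k0 kn nk]] := exists_floor_sqrt n0.
have nR : 0 < n%:R :> R by rewrite ltr0n.
have kR : 0 < k%:R :> R by rewrite ltr0n.
have s0 : 0 < Num.sqrt n%:R :> R by rewrite sqrtr_gt0.
have ks : k%:R <= Num.sqrt n%:R :> R.
  rewrite -[leLHS]ger0_norm ?(ltW kR)// -sqrtr_sqr ler_wsqrtr //.
  by rewrite -natrX ler_nat.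
rewrite sqrtrV ?(ltW nR)//; set s := Num.sqrt n%:R in s0 ks *.
have nE : n%:R = s * s by rewrite -expr2 sqr_sqrtr // ltW.
split.
  apply: le_trans (risk_rnwl_ge R k0 kn nk).
  by rewrite lee_fin -invfM lef_pV2 ?posrE ?mulr_gt0 ?exprn_gt0 // ler_wpM2l ?exprn_ge0.
apply: le_trans (risk_rnwl_le R k0 kn nk) _; rewrite lee_fin nE.
apply: (@le_trans _ _ (30 / s)); last first.
  by rewrite ler_wpM2r ?invr_ge0 ?(ltW s0) //; lra.
rewrite invfM mulrA ler_wpM2r ?invr_ge0 ?(ltW s0) //.
by rewrite -mulrA ler_piMr // ler_pdivrMr// mul1r.
Qed.
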